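(* Let $k\ge0$, $(E_\eta)_{\eta\in\mathbb N_0^n}$ the non-symmetric and $(P_\lambda)_{\lambda\in\Lambda_n^+}$ the symmetric Jack polynomials of index $1/k$. Then for all $\mu\in\mathbb C$ and all $x\in\mathbb R^n$ with $x_i\ne0$ for $i=1,\dots,n$: (1) $E_\eta(T)\Delta^{-\mu}(x)=(-1)^{|\eta|}[\mu]_{\eta_+}\,E_\eta\bigl(\tfrac1x\bigr)\,\Delta(x)^{-\mu}$ for all $\eta\in\mathbb N_0^n$; (2) $P_\lambda(T)\Delta^{-\mu}(x)=(-1)^{|\lambda|}[\mu]_{\lambda}\,P_\lambda\bigl(\tfrac1x\bigr)\,\Delta(x)^{-\mu}$ for all $\lambda\in\Lambda_n^+$.
   Context: $s_{ij}$ is the transposition of coordinates $i,j$. Dunkl operators of type $A_{n-1}$, multiplicity $k\ge0$: $T_\xi f(x)=\partial_\xi f(x)+k\sum_{i<j}(\xi_i-\xi_j)\frac{f(x)-f(s_{ij}x)}{x_i-x_j}$, $T_j=T_{e_j}$; they commute and for a polynomial $p$, $p(T)=p(T_1,\dots,T_n)$. $\Delta(x)=\prod_jx_j$ and $\Delta(x)^{-\mu}=\exp(-\mu\,\mathrm{Log}\,\Delta(x))$ (principal branch; smooth on the set where all $x_i\neq0$). $1/x$ is componentwise. $[\mu]_\eta=\prod_{j=1}^n(\mu-k(j-1))_{\eta_j}$ with Pochhammer symbols $(a)_m=a(a+1)\cdots(a+m-1)$. Jack polynomials: $\Lambda_n^+=\{\lambda\in\mathbb N_0^n:\lambda_1\ge\dots\ge\lambda_n\}$;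 $\eta_+$ decreasing rearrangement of $\eta$, $|\eta|=\sum\eta_i$. Dominance: $\mu\le_D\lambda$ iff $|\mu|=|\lambda|$ and partial sums of $\mu$ $\le$ those of $\lambda$. On $\mathbb N_0^n$: $\kappa\prec\eta$ iff $\kappa_+\le_D\eta_+$, $\kappa_+\ne\eta_+$, or $\kappa_+=\eta_+$ and $w_\eta<w_\kappa$ in Bruhat order, $w_\eta$ the shortest permutation with $w_\eta\eta_+=\eta$. Let $\mathcal D_j=x_jT_j+k(1-n)+k\sum_{i>j}s_{ij}$, $\overline\eta_j=\eta_j-k\#\{i<j:\eta_i\ge\eta_j\}-k\#\{i>j:\eta_i>\eta_j\}$. $E_\eta$ is the unique polynomial $x^\eta+\sum_{\kappa\prec\eta}c_{\eta\kappa}x^\kappa$ with $\mathcal D_jE_\eta=\overline\eta_jE_\eta$ for all $j$. $P_\lambda$ is the unique multiple of $\sum_{\sigma\in\mathcal S_n}E_\lambda(\sigma x)$ whose coefficient of $x^\lambda$ equals $1$. *)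

(* Defs.v *)
From HB Require Import structures.
From mathcomp Require Import all_boot all_order all_algebra all_fingroup.
From mathcomp Require Import mpoly.
From mathcomp Require Import all_classical all_reals all_analysis.
From mathcomp Require Import complex.
Set Implicit Arguments. Unset Strict Implicit. Unset Printing Implicit Defensive.
Import Order.TTheory GRing.Theory Num.Theory.
Local Open Scope ring_scope.
Local Open Scope complex_scope.

Section JackDunkl.
Context (R : realType) (n : nat).
Local Notation C := R[i].
Local Notation vec := 'rV[R]_n.

Definition ev (j : 'I_n) : vec := delta_mx 0 j.
Definition swap (i j : 'I_n) (x : vec) : vec := \row_l x 0 (tperm i j l).

Definition cexp (z : C) : C :=
  (expR (complex.Re z) * cos (complex.Im z)) +i* (expR (complex.Re z) * sin (complex.Im z)).
(* principal branch Log t = ln|t| + i Arg t, for a nonzero real t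
   (Arg t = 0 if t > 0, Arg t = pi if t < 0) *)
Definition LogR (t : R) : C := (ln `|t|) +i* (if t < 0 then pi else 0).

Definition Delta (x : vec) : R := \prod_(i < n) x 0 i.
Definition Delta_pow (mu : C) (x : vec) : C := cexp (- mu * LogR (Delta x)).

Definition cderive (f : vec -> C) (x v : vec) : C :=
  (derive (fun y => complex.Re (f y)) x v) +i* (derive (fun y => complex.Im (f y)) x v).

(* the difference quotient (f(x) - f(s_ij x)) / (x_i - x_j); on the hyperplane
   x_i = x_j it is given by its (continuous) extension (d_{e_i} - d_{e_j}) f(x) *)
Definition ddiff (f : vec -> C) (i j : 'I_n) (x : vec) : C :=
  if x 0 i != x 0 j then (f x - f (swap i j x)) / (x 0 i - x 0 j)%:C
  else cderive f x (ev i - ev j).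

Definition dunkl (k : R) (xi : vec) (f : vec -> C) : vec -> C := fun x =>
  cderive f x xi + k%:C * \sum_(i < n) \sum_(j < n | (i < j)%N)
     (xi 0 i - xi 0 j)%:C * ddiff f i j x.

Definition dunkl_mono (k : R) (m : mpoly.multinom n) (f : vec -> C) : vec -> C :=
  foldr (fun j g => iter (mpoly.fun_of_multinom m j) (dunkl k (ev j)) g) f (enum 'I_n).

Definition dunkl_poly (k : R) (p : mpoly.mpoly n R) (f : vec -> C) : vec -> C :=
  fun x => \sum_(m <- mpoly.msupp p) (mpoly.mcoeff m p)%:C * dunkl_mono k m f x.

Definition pfun (p : mpoly.mpoly n R) : vec -> C :=
  fun x => (mpoly.meval (fun i => x 0 i) p)%:C.

Definition poch (a : C) (m : nat) : C := \prod_(l < m) (a + l%:R%:C).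
(* [mu]_eta = prod_{j=1}^n (mu - k(j-1))_{eta_j}  (here j is 0-indexed) *)
Definition gen_poch (k : R) (mu : C) (eta : seq nat) : C :=
  \prod_(j < n) poch (mu - (k * j%:R)%:C) (nth 0%N eta j).

Definition mseq (m : mpoly.multinom n) : seq nat := val (mpoly.multinom_val m).
Definition sortd (s : seq nat) : seq nat := sort geq s.
Definition dominated (a b : seq nat) : Prop :=
  sumn a = sumn b /\ forall i : nat, (sumn (take i a) <= sumn (take i b))%N.
Definition pact (w : 'S_n) (s : seq nat) : seq nat :=
  [seq nth 0%N s (w^-1 i)%g | i <- enum 'I_n].
Definition plen (w : 'S_n) : nat :=
  #|[set p : 'I_n * 'I_n | (p.1 < p.2)%N && (w p.2 < w p.1)%N]|.
Inductive bruhat_lt : 'S_n -> 'S_n -> Prop :=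
| bruhat_step (u : 'S_n) (i j : 'I_n) :
    i != j -> (plen u < plen (u * tperm i j)%g)%N -> bruhat_lt u (u * tperm i j)%g
| bruhat_trans (u v w : 'S_n) : bruhat_lt u v -> bruhat_lt v w -> bruhat_lt u w.
Definition is_wmin (eta : seq nat) (w : 'S_n) : Prop :=
  pact w (sortd eta) = eta /\
  forall w' : 'S_n, pact w' (sortd eta) = eta -> (plen w <= plen w')%N.
Definition jprec (kappa eta : seq nat) : Prop :=
  (dominated (sortd kappa) (sortd eta) /\ sortd kappa <> sortd eta) \/
  (sortd kappa = sortd eta /\
   exists we wk : 'S_n, [/\ is_wmin eta we, is_wmin kappa wk & bruhat_lt we wk]).

Definition cherD (k : R) (j : 'I_n) (f : vec -> C) : vec -> C := fun x =>
  (x 0 j)%:C * dunkl k (ev j) f x + (k * (1 - n%:R))%:C * f x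
  + k%:C * \sum_(i < n | (j < i)%N) f (swap i j x).

Definition ebar (k : R) (eta : seq nat) (j : 'I_n) : R :=
  (nth 0%N eta j)%:R
  - k * (#|[set i : 'I_n | (i < j)%N && (nth 0%N eta j <= nth 0%N eta i)%N]|)%:R
  - k * (#|[set i : 'I_n | (j < i)%N && (nth 0%N eta j < nth 0%N eta i)%N]|)%:R.

Definition is_Ejack (k : R) (eta : mpoly.multinom n) (E : mpoly.mpoly n R) : Prop :=
  [/\ mpoly.mcoeff eta E = 1,
      (forall m : mpoly.multinom n, m \in mpoly.msupp E -> m != eta -> jprec (mseq m) (mseq eta)) &
      forall (j : 'I_n) (x : vec), cherD k j (pfun E) x = (ebar k (mseq eta) j)%:C * pfun E x].

Definition is_Pjack (k : R) (lam : mpoly.multinom n) (P : mpoly.mpoly n R) : Prop :=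
  exists E, is_Ejack k lam E /\
  exists c : R, P = c *: (\sum_(s : 'S_n) mpoly.msym s E) /\ mpoly.mcoeff lam P = 1.

End JackDunkl.

(* Main.v *)
Require Import Defs.
From HB Require Import structures.
From mathcomp Require Import all_boot all_order all_algebra all_fingroup.
From mathcomp Require Import ssrcomplements mpoly.
From mathcomp Require Import ring zify.
Import Order.TTheory GRing.Theory Num.Theory.
Local Open Scope ring_scope.

(** In the coordinates [y = 1/x], the Dunkl operator [T_j] acts on functions
    [p(y) Delta^-mu] as an operator [S_j] on polynomials [p], namely
    [S_j = - y_j (T_j y_j + mu - 1 - k (n - 1))]. The [S_j] commute, so that
    [A p = p(S) 1] is characterised by [A 1 = 1] and [A (y_j p) = S_j (A p)],
    and [A] commutes with permutations. Up to such permutations, the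
    nonsymmetric Jack polynomials are generated from [1] by the maps
    [F -> s_i F + c F] and [F -> y_1 F] followed by a cyclic shift. Along the
    first one an eigenvalue of [A] is unchanged; along the second one it gets
    multiplied by [- (mu + eigenvalue of D_1)], since [S_1 = - y_1 (D_1 + mu)].
    Finally the Cherednik operators are triangular on monomials with pairwise
    different joint eigenvalues, so that the Cherednik equations alone
    determine [E_eta] up to a factor. *)

(** The form of [S_j] comes from the substitution [y = 1/x]: d/dx_j becomes - y_j^2 d/dy_j, the
    logarithmic derivative of Delta^-mu contributes - mu y_j, and 1/(x_j - x_i) = - y_j y_i / (y_j -
    y_i). Moving [y_j] inside [T_j] gives the stated expression, and in that shape the commutation
    of the [S_j] reduces to that of the [T_j]. The factor - (mu + eigenvalue) is, up to sign, the
    next factor of a Pochhammer symbol, because the eigenvalue of D_1 is the first exponent minus k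
    times its rank in the decreasing rearrangement. The first map yields a nonzero eigenvector
    because eigenvalues at two distinct exponents differ by more than k; this is where k >= 0
    enters. On the analytic side, iterated Dunkl operators are controlled only where no coordinate
    vanishes, and on x_i = x_j the difference quotient is a derivative. The lemmas there are
    therefore stated for any function that agrees with p(1/x) Delta^-mu off the coordinate
    hyperplanes, and each treats the diagonal separately. *)

Lemma mnm_ind n (P : 'X_{1..n} -> Prop) :
  P 0%MM -> (forall i m, P m -> P (U_(i) + m)%MM) -> forall m, P m.
Proof.
move=> P0 PS m; have [d] := ubnP (mdeg m).
elim: d m => // d IH m; rewrite ltnS => le_md.
have [->|] := eqVneq m 0%MM; first exact: P0.
rewrite -mdeg_eq0 mdegE => /eqP sum_n0.
have [i mi|m0] := pickP (fun i => m i != 0%N); last first.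
  by case: sum_n0; apply: big1 => i _; apply/eqP; rewrite -[_ == _]negbK m0.
have mE : m = (U_(i) + (m - U_(i)))%MM.
  by rewrite addmC submK // lep1mP.
rewrite mE; apply/PS/IH; move: le_md; rewrite {1}mE mdegD mdeg1 add1n.
exact: leq_trans.
Qed.

(** * Divided differences of polynomials *)

Section DividedDifference.
Context {K : idomainType} {n : nat}.
Implicit Types (p q : {mpoly K[n]}) (i j l : 'I_n) (s : 'S_n).

Lemma mpoly_indX (P : {mpoly K[n]} -> Prop) :
  P 1 -> (forall c p q, P p -> P q -> P (c *: p + q)) ->
  (forall i p, P p -> P ('X_i * p)) -> forall p, P p.
Proof.
move=> P1 PL PX; elim/mpolyind => [|c m p _ _ Pp].
  by have := PL (-1) _ _ P1 P1; rewrite scaleN1r addNr.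
apply: PL => //; elim/mnm_ind: m => [|i m IH]; first by rewrite mpolyX0.
by rewrite mpolyXD; apply: PX.
Qed.

Lemma msymXU s i : msym s 'X_i = 'X_(s i) :> {mpoly K[n]}.
Proof.
rewrite msymX; congr 'X_[_]; apply/mnmP => j.
by rewrite mnmE !mnm1E -(inj_eq (@perm_inj _ s)) permKV.
Qed.

Lemma msym_tpermK i j p : msym (tperm i j) (msym (tperm i j) p) = p.
Proof. by rewrite -msymMm tperm2 msym1m. Qed.

Lemma msym_tpermJ s i j p :
  msym s (msym (tperm i j) p) = msym (tperm (s i) (s j)) (msym s p).
Proof. by rewrite -!msymMm -tpermJ conjgE !mulgA mulgV mul1g. Qed.

(** The twisted Leibniz rule turns a quotient for [p] into one for ['X_l * p], so divisibility
    spreads from 1. The boolean equality makes the quotient available to [xchoose]. *)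
Lemma ddiff_exists i j p :
  exists q, ('X_i - 'X_j) * q == p - msym (tperm i j) p.
Proof.
elim/mpoly_indX: p => [|c p q [p' /eqP Ep] [q' /eqP Eq]|l p [q /eqP Eq]].
- by exists 0; rewrite mulr0 msym1 subrr.
- exists (c *: p' + q'); rewrite msymD msymZ mulrDr -scalerAr Ep Eq.
  by rewrite scalerBr opprD addrACA.
exists ('X_l * q + ((l == i)%:R - (l == j)%:R) * msym (tperm i j) p).
apply/eqP; rewrite msymM msymXU mulrDr mulrCA Eq.
case: tpermP => [->|->|/eqP/negPf-> /eqP/negPf->]; rewrite ?eqxx; last by ring.
  by case: eqP => [->|_] /=; ring.
by rewrite [_ == i]eq_sym; case: eqP => [->|_] /=; ring.
Qed.

(** The value 0 on [i == j] lets linearity, antisymmetry and equivariance hold without a side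
    condition. *)
Definition mddiff i j p : {mpoly K[n]} :=
  if i == j then 0 else xchoose (ddiff_exists i j p).

Lemma mddiffE i j p : ('X_i - 'X_j) * mddiff i j p = p - msym (tperm i j) p.
Proof.
rewrite /mddiff; have [->|_] := eqVneq; last exact/eqP/(xchooseP (ddiff_exists i j p)).
by rewrite tperm1 msym1m !subrr mulr0.
Qed.

Lemma subXU_neq0 i j : i != j -> 'X_i - 'X_j != 0 :> {mpoly K[n]}.
Proof.
move=> ij; apply/eqP => /(congr1 (mcoeff U_(i))) /eqP.
by rewrite mcoeffB !mcoeffXU eqxx [j == i]eq_sym (negPf ij) subr0 mcoeff0 oner_eq0.
Qed.

Lemma mddiff_unique i j p q : i != j ->
  ('X_i - 'X_j) * q = p - msym (tperm i j) p -> mddiff i j p = q.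
Proof.
by move=> ij Eq; apply: (mulfI (subXU_neq0 _ _ ij)); rewrite mddiffE Eq.
Qed.

Lemma mddiff_is_linear i j : linear (mddiff i j).
Proof.
move=> c p q; have [->|ij] := eqVneq i j; first by rewrite /mddiff eqxx scaler0 addr0.
apply: mddiff_unique => //; rewrite mulrDr -scalerAr !mddiffE msymD msymZ.
by rewrite scalerBr opprD addrACA.
Qed.

HB.instance Definition _ i j :=
  GRing.isLinear.Build K {mpoly K[n]} {mpoly K[n]} *:%R (mddiff i j)
    (mddiff_is_linear i j).

Lemma mddiff1 i j : mddiff i j 1 = 0.
Proof.
have [->|ij] := eqVneq i j; first by rewrite /mddiff eqxx.
by apply: mddiff_unique => //; rewrite mulr0 msym1 subrr.
Qed.

Lemma mddiffX i j l p : i != j ->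
  mddiff i j ('X_l * p) =
  'X_l * mddiff i j p + ((l == i)%:R - (l == j)%:R) * msym (tperm i j) p.
Proof.
move=> ij; apply: mddiff_unique => //.
rewrite msymM msymXU mulrDr mulrCA mddiffE.
case: tpermP => [->|->|/eqP/negPf-> /eqP/negPf->]; rewrite ?eqxx; last by ring.
  by rewrite (negPf ij) /=; ring.
by rewrite [j == i]eq_sym (negPf ij) /=; ring.
Qed.

Lemma mddiffC i j p : mddiff j i p = - mddiff i j p.
Proof.
have [->|ij] := eqVneq i j; first by rewrite /mddiff eqxx oppr0.
apply: mddiff_unique; first by rewrite eq_sym.
by rewrite mulrN -mulNr opprB mddiffE tpermC.
Qed.

Lemma mddiff_tperm i j p : mddiff i j (msym (tperm i j) p) = - mddiff i j p.
Proof.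
have [->|ij] := eqVneq i j; first by rewrite /mddiff eqxx oppr0.
by apply: mddiff_unique => //; rewrite mulrN mddiffE opprB msym_tpermK.
Qed.

Lemma msym_mddiff s i j p :
  msym s (mddiff i j p) = mddiff (s i) (s j) (msym s p).
Proof.
have [->|ij] := eqVneq i j; first by rewrite /mddiff !eqxx msym0.
apply/esym/mddiff_unique; first by rewrite (inj_eq perm_inj).
by rewrite -!msymXU -msymB -msymM mddiffE msymB msym_tpermJ.
Qed.

Lemma mderiv_X l i p : ('X_l * p)^`M(i) = 'X_l * p^`M(i) + (l == i)%:R * p.
Proof.
rewrite mderivM mderivX mnm1E addrC; congr (_ + _); have [->|_] := eqVneq.
  by rewrite scale1r -[X in (X - _)%MM]add0m addmK mpolyX0.
by rewrite scale0r.
Qed.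

Lemma msym_mderiv s i p : msym s p^`M(i) = (msym s p)^`M(s i).
Proof.
elim/mpoly_indX: p => [|c p q Ep Eq|l p Ep].
- by rewrite msym1 -mpolyC1 !mderivC msym0.
- by rewrite !(mderivD, mderivZ, msymD, msymZ) Ep Eq.
rewrite !(mderiv_X, msymM, msymD, msymXU) Ep (inj_eq perm_inj).
by rewrite rmorph_nat.
Qed.

Lemma meval_msym (v : 'I_n -> K) s p :
  meval v (msym s p) = meval (fun i => v (s i)) p.
Proof.
elim/mpoly_indX: p => [|c p q Ep Eq|l p Ep].
- by rewrite msym1 !meval1.
- by rewrite !(mevalD, mevalZ, msymD, msymZ) Ep Eq.
by rewrite !(mevalM, msymM, msymXU, mevalXU) Ep.
Qed.

(** Differentiate [mddiffE] in the variable [i] and evaluate: the factor v_i - v_j kills the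
    derivative of the quotient and leaves the quotient itself. This matches the convention for
    [ddiff] on the hyperplane x_i = x_j. *)
Lemma meval_mddiff_diag (v : 'I_n -> K) i j p : i != j -> v i = v j ->
  meval v (mddiff i j p) = meval v p^`M(i) - meval v p^`M(j).
Proof.
move=> ij vij.
have := congr1 (fun q => meval v q^`M(i)) (mddiffE i j p).
have vs : (fun l => v (tperm i j l)) =1 v by move=> l; case: tpermP => [->|->|].
rewrite mulrBl !mderivB !mderiv_X eqxx [j == i]eq_sym (negPf ij).
rewrite -[X in _ - mderiv X _](tpermR i j) -msym_mderiv !(mevalB, mevalD, mevalM).
rewrite meval_msym (meval_eq _ vs) !mevalXU !rmorph_nat vij mul1r mul0r addr0.
by rewrite addrAC subrr add0r.
Qed.

Lemma mevalB_msym (v : 'I_n -> K) i j p :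
  meval v p - meval v (msym (tperm i j) p) = (v i - v j) * meval v (mddiff i j p).
Proof. by rewrite -mevalB -mddiffE mevalM mevalB !mevalXU. Qed.

Definition meval_deriv (v d : 'I_n -> K) p : K := \sum_i d i * meval v p^`M(i).

Lemma meval_deriv1 v d : meval_deriv v d 1 = 0.
Proof.
by apply: big1 => i _; rewrite -mpolyC1 mderivC meval0 mulr0.
Qed.

Lemma meval_deriv_lin v d c p q :
  meval_deriv v d (c *: p + q) = c * meval_deriv v d p + meval_deriv v d q.
Proof.
rewrite /meval_deriv mulr_sumr -big_split; apply: eq_bigr => i _ /=.
by rewrite mderivD mderivZ mevalD mevalZ; ring.
Qed.

Lemma meval_derivX v d l p :
  meval_deriv v d ('X_l * p) = d l * meval v p + v l * meval_deriv v d p.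
Proof.
rewrite /meval_deriv (eq_bigr (fun i => v l * (d i * meval v p^`M(i))
    + (l == i)%:R * (d i * meval v p))) => [|i _]; last first.
  by rewrite mderiv_X mevalD !mevalM mevalXU rmorph_nat; ring.
rewrite big_split -mulr_sumr /= addrC; congr (_ + _).
rewrite (bigD1 l) //= eqxx mul1r big1 ?addr0 // => i.
by rewrite eq_sym => /negPf->; rewrite mul0r.
Qed.

End DividedDifference.

Lemma meval_map_mpoly (K L : idomainType) n (f : {rmorphism K -> L})
    (v : 'I_n -> K) (p : {mpoly K[n]}) :
  meval (fun i => f (v i)) (map_mpoly f p) = f (meval v p).
Proof.
elim/(@mpoly_indX K): p => [|c p q Ep Eq|i p Ep].
- by rewrite -mpolyC1 map_mpolyC !mevalC.
- by rewrite (raddfD (map_mpoly f)) /= map_mpolyZ !mevalD !mevalZ Ep Eq rmorphD rmorphM.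
by rewrite (rmorphM (map_mpoly f)) /= map_mpolyX !mevalM !mevalXU Ep rmorphM.
Qed.

Lemma map_mpoly_sum_msym (K L : idomainType) n (f : {rmorphism K -> L})
    (c : K) (p : {mpoly K[n]}) :
  map_mpoly f (c *: \sum_(s : 'S_n) msym s p) =
  f c *: \sum_(s : 'S_n) msym s (map_mpoly f p).
Proof.
rewrite map_mpolyZ; congr (_ *: _); rewrite (raddf_sum (map_mpoly f)) /=.
apply: eq_bigr => s _; apply/mpolyP => m.
by rewrite mcoeff_map_mpoly !mcoeff_sym mcoeff_map_mpoly.
Qed.

(** * Commutation relations of Dunkl, inverted Dunkl and Cherednik operators *)

HB.lock Definition mdunkl {K : idomainType} {n : nat} (k : K) (j : 'I_n)
    (p : {mpoly K[n]}) : {mpoly K[n]} :=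
  p^`M(j) + k *: \sum_(i < n | i != j) mddiff j i p.

(* The action of the Dunkl operator on [p(1/x) Delta(x)^-mu], read off on [p]. *)
HB.lock Definition idunkl {K : idomainType} {n : nat} (k mu : K) (j : 'I_n)
    (p : {mpoly K[n]}) : {mpoly K[n]} :=
  - 'X_j * (mdunkl k j ('X_j * p) + (mu - 1 - k * (n%:R - 1)) *: p).

HB.lock Definition mcherednik {K : idomainType} {n : nat} (k : K) (j : 'I_n)
    (p : {mpoly K[n]}) : {mpoly K[n]} :=
  'X_j * mdunkl k j p + (k * (1 - n%:R)) *: p
  + k *: \sum_(i < n | (j < i)%N) msym (tperm j i) p.

Section DunklAlgebra.
Context {K : idomainType} {n : nat} (k : K).
Implicit Types (p q : {mpoly K[n]}) (i j l : 'I_n) (s : 'S_n).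
Local Notation mdunkl := (mdunkl k).
Local Notation idunkl := (idunkl k).
Local Notation mcherednik := (mcherednik k).

Lemma mdunkl_is_linear j : linear (mdunkl j).
Proof.
move=> c p q; rewrite mdunkl.unlock mderivD mderivZ scalerDr addrACA; congr (_ + _).
rewrite scalerA mulrC -scalerA -scalerDr; congr (_ *: _).
rewrite scaler_sumr -big_split /=; apply: eq_bigr => i _.
by rewrite linearP.
Qed.

HB.instance Definition _ j :=
  GRing.isLinear.Build K {mpoly K[n]} {mpoly K[n]} *:%R (mdunkl j)
    (mdunkl_is_linear j).

Lemma mdunklD j : {morph mdunkl j : p q / p + q}.
Proof. exact: linearD. Qed.

Lemma mdunklN j : {morph mdunkl j : p / - p}.
Proof. exact: linearN. Qed.

Lemma mdunklB j : {morph mdunkl j : p q / p - q}.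
Proof. exact: linearB. Qed.

Lemma mdunklZ j c p : mdunkl j (c *: p) = c *: mdunkl j p.
Proof. exact: linearZ. Qed.

Lemma mdunkl1 j : mdunkl j 1 = 0.
Proof.
rewrite mdunkl.unlock -mpolyC1 mderivC add0r big1 ?scaler0 // => i _.
by rewrite mpolyC1 mddiff1.
Qed.

Lemma mdunklX j l p : l != j ->
  mdunkl j ('X_l * p) = 'X_l * mdunkl j p - k *: msym (tperm j l) p.
Proof.
move=> lj; rewrite mdunkl.unlock mderiv_X (negPf lj) mul0r addr0 mulrDr -addrA.
congr (_ + _); rewrite -scalerAr -scalerBr mulr_sumr; congr (_ *: _).
rewrite (bigD1 l) //= [in RHS](bigD1 l) //=.
rewrite mddiffX ?[j == l]eq_sym // (negPf lj) eqxx -!addrA; congr (_ + _).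
rewrite sub0r mulN1r [RHS]addrC; congr (_ + _).
apply: eq_bigr => i /andP[ij il]; rewrite mddiffX ?[j == i]eq_sym //.
by rewrite (negPf lj) [l == i]eq_sym (negPf il) subrr mul0r addr0.
Qed.

Lemma mdunklXX j p :
  mdunkl j ('X_j * p) =
  'X_j * mdunkl j p + p + k *: \sum_(i | i != j) msym (tperm j i) p.
Proof.
rewrite mdunkl.unlock mderiv_X eqxx mul1r mulrDr -!addrA; congr (_ + _).
rewrite addrCA; congr (_ + _); rewrite -scalerAr -scalerDr mulr_sumr -big_split.
congr (_ *: _); apply: eq_bigr => i ij; have ji : j != i by rewrite eq_sym.
by rewrite mddiffX // eqxx (negPf ji) subr0 mul1r.
Qed.

Lemma msym_mdunkl s j p : msym s (mdunkl j p) = mdunkl (s j) (msym s p).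
Proof.
rewrite mdunkl.unlock msymD msymZ msym_mderiv; congr (_ + _ *: _).
rewrite (raddf_sum (msym s)) [RHS](reindex_inj (@perm_inj _ s)) /=.
by apply: eq_big => [i|i _]; rewrite ?(inj_eq perm_inj) ?msym_mddiff.
Qed.

(** Induction on multiplication by a variable ['X_l]; the relations [mdunklX] and [mdunklXX] push
    both operators past it, and only the cases [l] in {i, j} and [l] outside differ. *)
Lemma mdunkl_comm i j p : mdunkl i (mdunkl j p) = mdunkl j (mdunkl i p).
Proof.
have [->//|ij] := eqVneq i j.
elim/(@mpoly_indX K): p => [|c p q Ep Eq|l p Ep]; first by rewrite !mdunkl1 !linear0.
  by rewrite !mdunkl_is_linear Ep Eq.
have Hl a b : a != b -> mdunkl a (mdunkl b p) = mdunkl b (mdunkl a p) ->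
    mdunkl a (mdunkl b ('X_b * p)) = mdunkl b (mdunkl a ('X_b * p)).
  move=> ab E; have ba : b != a by rewrite eq_sym.
  rewrite mdunklXX [mdunkl a ('X_b * p)]mdunklX //.
  rewrite !mdunklD mdunklN !mdunklZ mdunklX // mdunklXX E (raddf_sum (mdunkl a)) /=.
  (* The transposition of [a] and [b] is split off: it exchanges the two operators, whereas every
     other reflection in the sum fixes [a] and commutes with the operator at [a]. *)
  rewrite !(bigD1 a (P := fun i => i != b)) //=.
  have -> : mdunkl a (msym (tperm b a) p) = msym (tperm a b) (mdunkl b p).
    by rewrite msym_mdunkl tpermR tpermC.
  have -> : mdunkl b (msym (tperm a b) p) = msym (tperm a b) (mdunkl a p).
    by rewrite msym_mdunkl tpermL.
  have -> : \sum_(m | (m != b) && (m != a)) mdunkl a (msym (tperm b m) p) =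
            \sum_(m | (m != b) && (m != a)) msym (tperm b m) (mdunkl a p).
    by apply: eq_bigr => m /andP[mb ma]; rewrite msym_mdunkl tpermD.
  by rewrite !scalerDr [tperm b a]tpermC -!mul_mpolyC; ring.
have [->|li] := eqVneq l i; first by rewrite (Hl j i) // eq_sym.
have [->|lj] := eqVneq l j; first exact: Hl.
have F a b : l != a -> l != b -> a != b ->
    mdunkl a (msym (tperm b l) p) = msym (tperm b l) (mdunkl a p).
  by move=> la lb ab; rewrite msym_mdunkl tpermD // eq_sym.
have H a b : l != a -> l != b -> a != b -> mdunkl a (mdunkl b ('X_l * p)) =
    'X_l * mdunkl a (mdunkl b p) - k *: msym (tperm a l) (mdunkl b p)
      - k *: msym (tperm b l) (mdunkl a p).
  move=> la lb ab; rewrite (mdunklX b l) // mdunklB mdunklZ F //.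
  by rewrite (mdunklX a l).
have ji : j != i by rewrite eq_sym.
rewrite (H i j li lj ij).
rewrite (H j i lj li ji).
rewrite Ep; exact: addrAC.
Qed.

(** This is the shape that the change of variables y = 1/x produces. The constants in [idunkl] come
    from here: the 1 is the Leibniz term of [mdunklXX], and n - 1 counts the copies of [p] obtained
    from writing each reflection as [p] minus a multiple of a divided difference. *)
Lemma idunklE mu l p : idunkl mu l p =
  - 'X_l * ('X_l * p^`M(l) + mu *: p + k *: \sum_(j | j != l) 'X_j * mddiff l j p).
Proof.
rewrite idunkl.unlock mdunklXX mdunkl.unlock.
have -> : \sum_(j | j != l) 'X_j * mddiff l j p = 'X_l * \sum_(j | j != l) mddiff l j p
    + \sum_(j | j != l) msym (tperm l j) p - (n%:R - 1) *: p.
  have -> : n%:R - 1 = #|predC1 l|%:R :> K.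
    by rewrite cardC1 card_ord -subn1 natrB // (leq_trans _ (ltn_ord l)).
  rewrite scaler_nat -sumr_const mulr_sumr -big_split -sumrB /=.
  apply: eq_bigr => j _.
  have -> : msym (tperm l j) p = p - ('X_l - 'X_j) * mddiff l j p.
    by rewrite mddiffE opprB addrC subrK.
  by ring.
rewrite -!mul_mpolyC !(mpolyCM, mpolyCB, mpolyC1); ring.
Qed.

Lemma meval_idunkl (v : 'I_n -> K) mu l p : meval v (idunkl mu l p) =
  - (v l * (v l * meval v p^`M(l) + mu * meval v p))
  + k * \sum_(j | j != l) - (v l * v j * meval v (mddiff l j p)).
Proof.
have E : meval v (\sum_(j | j != l) 'X_j * mddiff l j p) =
    \sum_(j | j != l) v j * meval v (mddiff l j p).
  rewrite [LHS](raddf_sum (meval v)); apply: eq_bigr => j _.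
  by rewrite /= mevalM mevalXU.
rewrite idunklE mevalM mevalN !mevalD mevalM !mevalZ !mevalXU E.
have -> : \sum_(j | j != l) - (v l * v j * meval v (mddiff l j p)) =
    - v l * \sum_(j | j != l) v j * meval v (mddiff l j p).
  by rewrite mulr_sumr; apply: eq_bigr => j _; ring.
by ring.
Qed.

Lemma idunkl_is_linear mu j : linear (idunkl mu j).
Proof.
move=> c p q; rewrite idunkl.unlock.
have -> : 'X_j * (c *: p + q) = c *: ('X_j * p) + 'X_j * q.
  by rewrite mulrDr scalerAr.
by rewrite mdunkl_is_linear -!mul_mpolyC; ring.
Qed.

HB.instance Definition _ mu j :=
  GRing.isLinear.Build K {mpoly K[n]} {mpoly K[n]} *:%R (idunkl mu j)
    (idunkl_is_linear mu j).

Lemma msym_idunkl mu s j p : msym s (idunkl mu j p) = idunkl mu (s j) (msym s p).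
Proof.
by rewrite idunkl.unlock !(msymM, msymN, msymD, msymZ, msym_mdunkl, msymXU).
Qed.

(** Identifies the part of a product of two inverted operators that is symmetric in [i] and [j]
    thanks to [mdunkl_comm]. *)
Lemma mdunkl_mulX2 i j p : i != j ->
  mdunkl i ('X_i * mdunkl j ('X_j * p)) -
    k *: msym (tperm i j) (mdunkl j ('X_j * p)) =
  mdunkl i (mdunkl j ('X_i * ('X_j * p))).
Proof.
move=> ij; rewrite [mdunkl j ('X_i * _)]mdunklX // mdunklB mdunklZ.
by rewrite !msym_mdunkl tpermR [tperm j i]tpermC.
Qed.

Lemma idunkl_comm mu i j p :
  idunkl mu i (idunkl mu j p) = idunkl mu j (idunkl mu i p).
Proof.
have [->//|ij] := eqVneq i j.
set c := mu - 1 - k * (n%:R - 1).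
(* Once [mdunkl_comm] is applied, the right-hand side is symmetric in [a] and [b], which is all that
   is needed. *)
have H a b : a != b -> idunkl mu a (idunkl mu b p) = 'X_a * 'X_b *
   (mdunkl a (mdunkl b ('X_a * ('X_b * p))) +
    (c *: mdunkl a ('X_a * p) + c *: mdunkl b ('X_b * p)) + (c * c) *: p
    - (k * c) *: msym (tperm a b) p).
  move=> ab; have ba : b != a by rewrite eq_sym.
  rewrite -(mdunkl_mulX2 _ _ _ ab) {1}idunkl.unlock -/c.
  have -> : 'X_a * (idunkl mu b p) =
      - ('X_b * ('X_a * mdunkl b ('X_b * p) + c *: ('X_a * p))).
    by rewrite idunkl.unlock -/c -!mul_mpolyC; ring.
  rewrite mdunklN mdunklX // mdunklD mdunklZ msymD msymZ !msymM !msymXU tpermL.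
  rewrite idunkl.unlock -/c -!mul_mpolyC !mpolyCM; ring.
have ji : j != i by rewrite eq_sym.
rewrite (H i j ij) (H j i ji) [tperm j i]tpermC mdunkl_comm.
rewrite [in RHS](mulrCA 'X_j) [in RHS](addrC (c *: mdunkl j _)).
by rewrite [in RHS](mulrC 'X_j 'X_i).
Qed.

(** With ['X_j] inside the Dunkl operator the sum runs over the smaller indices. It is empty at the
    first index, which makes the inverted operator there equal to - y_1 (D_1 + mu). *)
Lemma mcherednikE j p :
  mcherednik j p = mdunkl j ('X_j * p) - (1 + k * (n%:R - 1)) *: p
    - k *: \sum_(i < n | (i < j)%N) msym (tperm j i) p.
Proof.
have -> : mdunkl j ('X_j * p) = 'X_j * mdunkl j p + p + k *:
    (\sum_(i < n | (i < j)%N) msym (tperm j i) p +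
     \sum_(i < n | (j < i)%N) msym (tperm j i) p).
  rewrite mdunklXX (bigID (fun i : 'I_n => (i < j)%N)) /=.
  congr (_ + _ *: (_ + _)); apply: eq_bigl => i;
    by rewrite -(inj_eq val_inj) /=; case: ltngtP.
rewrite mcherednik.unlock.
rewrite -!mul_mpolyC !(mpolyCD, mpolyCM, mpolyCN, mpolyCB) ?mpolyC1; ring.
Qed.

Lemma mcherednik_is_linear j : linear (mcherednik j).
Proof.
move=> c p q; rewrite mcherednik.unlock mdunkl_is_linear.
rewrite (eq_bigr (fun i => c *: msym (tperm j i) p + msym (tperm j i) q)).
  rewrite big_split -scaler_sumr -!mul_mpolyC /=; ring.
by move=> i _; rewrite msymD msymZ.
Qed.

HB.instance Definition _ j :=
  GRing.isLinear.Build K {mpoly K[n]} {mpoly K[n]} *:%R (mcherednik j)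
    (mcherednik_is_linear j).

Lemma mcherednikD j : {morph mcherednik j : p q / p + q}.
Proof. exact: linearD. Qed.

Lemma mcherednikZ j c p : mcherednik j (c *: p) = c *: mcherednik j p.
Proof. exact: linearZ. Qed.

(** A permutation transports everything in the Cherednik operator except the order of the indices;
    the whole defect sits in the range of the last sum. *)
Lemma mcherednik_msym s j p :
  mcherednik (s j) (msym s p) =
  msym s (mdunkl j ('X_j * p) - (1 + k * (n%:R - 1)) *: p
    - k *: \sum_(i < n | (s i < s j)%N) msym (tperm j i) p).
Proof.
rewrite mcherednikE !(msymB, msymZ) msym_mdunkl msymM msymXU.
have -> : \sum_(i < n | (i < s j)%N) msym (tperm (s j) i) (msym s p) =
    msym s (\sum_(i < n | (s i < s j)%N) msym (tperm j i) p).
  rewrite (reindex_inj (@perm_inj _ s)) (raddf_sum (msym s)).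
  by apply: eq_bigr => i _; exact/esym/msym_tpermJ.
by [].
Qed.

End DunklAlgebra.

(** * Polynomials in the inverted Dunkl operators, applied to 1 *)

Section InvertedDunkl.
Context {K : idomainType} {n : nat} (k mu : K).
Implicit Types (p q : {mpoly K[n]}) (i j l : 'I_n) (s : 'S_n) (m : 'X_{1..n}).

Definition idunkl_seq m r p : {mpoly K[n]} :=
  foldr (fun j q => iter (m j) (idunkl k mu j) q) p r.

Definition idunkl_mono m : {mpoly K[n]} := idunkl_seq m (enum 'I_n) 1.

Lemma iter_idunkl_comm i j d p :
  idunkl k mu i (iter d (idunkl k mu j) p) = iter d (idunkl k mu j) (idunkl k mu i p).
Proof. by elim: d => //= d <-; rewrite idunkl_comm. Qed.

(** The fold fixes an order of the operators, as [dunkl_mono] does; commutation brings the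
    additional one to the front. *)
Lemma idunkl_seqDU l m r p : uniq r ->
  idunkl_seq (U_(l) + m)%MM r p =
  if l \in r then idunkl k mu l (idunkl_seq m r p) else idunkl_seq m r p.
Proof.
elim: r => //= j r IH /andP[jr /IH {}IH].
rewrite IH mnmDE mnm1E in_cons; case: eqVneq => [->|_] /=.
  by rewrite (negPf jr).
by rewrite add0n; case: ifP => // _; rewrite iter_idunkl_comm.
Qed.

Lemma idunkl_monoDU l m : idunkl_mono (U_(l) + m)%MM = idunkl k mu l (idunkl_mono m).
Proof. by rewrite /idunkl_mono idunkl_seqDU ?enum_uniq // mem_enum. Qed.

Lemma idunkl_mono0 : idunkl_mono 0%MM = 1.
Proof.
by rewrite /idunkl_mono /idunkl_seq; elim: (enum _) => //= j r ->; rewrite mnm0E.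
Qed.

(* [p(S) 1] for the commuting operators [S_j = idunkl k mu j]. *)
Definition idunkl_poly p : {mpoly K[n]} :=
  \sum_(m <- msupp p) p@_m *: idunkl_mono m.

(** Replaces the support by an index set common to several polynomials, so that linearity can be
    checked term by term. *)
Lemma idunkl_polywE d p : (msize p <= d)%N ->
  idunkl_poly p = \sum_(m : 'X_{1..n < d}) p@_m *: idunkl_mono m.
Proof.
move=> pd; pose I : subFinType _ := 'X_{1..n < d}.
rewrite /idunkl_poly (ssrcomplements.big_mksub I) ?msupp_uniq //=; last first.
  by move=> x /msize_mdeg_lt /leq_trans; apply.
rewrite big_rmcond //= => m /memN_msupp_eq0 ->.
by rewrite scale0r.
Qed.

Lemma idunkl_poly_is_linear : linear idunkl_poly.
Proof.
move=> c p q; pose d := maxn (msize (c *: p + q)) (maxn (msize p) (msize q)).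
rewrite !(@idunkl_polywE d) ?leq_max ?leqnn ?orbT //.
rewrite scaler_sumr -big_split /=; apply: eq_bigr => m _.
by rewrite mcoeffD mcoeffZ scalerDl scalerA.
Qed.

HB.instance Definition _ :=
  GRing.isLinear.Build K {mpoly K[n]} {mpoly K[n]} *:%R idunkl_poly
    idunkl_poly_is_linear.

Lemma idunkl_polyD : {morph idunkl_poly : p q / p + q}.
Proof. exact: linearD. Qed.

Lemma idunkl_polyZ c p : idunkl_poly (c *: p) = c *: idunkl_poly p.
Proof. exact: linearZ. Qed.

Lemma idunkl_polyX m : idunkl_poly 'X_[m] = idunkl_mono m.
Proof. by rewrite /idunkl_poly msuppX big_seq1 mcoeffX eqxx scale1r. Qed.

Lemma idunkl_poly1 : idunkl_poly 1 = 1.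
Proof. by rewrite -mpolyX0 idunkl_polyX idunkl_mono0 mpolyX0. Qed.

Lemma idunkl_polyM l p : idunkl_poly ('X_l * p) = idunkl k mu l (idunkl_poly p).
Proof.
elim/mpolyind: p => [|c m p _ _ IH]; first by rewrite mulr0 !raddf0.
rewrite mulrDr -scalerAr -mpolyXD !idunkl_poly_is_linear idunkl_is_linear.
by rewrite IH !idunkl_polyX idunkl_monoDU.
Qed.

Lemma msym_idunkl_poly s p : idunkl_poly (msym s p) = msym s (idunkl_poly p).
Proof.
elim/(@mpoly_indX K): p => [|c p q Ep Eq|l p Ep].
- by rewrite msym1 idunkl_poly1 msym1.
- by rewrite msymD msymZ !idunkl_poly_is_linear Ep Eq msymD msymZ.
by rewrite msymM msymXU !idunkl_polyM Ep msym_idunkl.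
Qed.

Lemma idunkl_poly_sum_msym a c p : idunkl_poly p = a *: p ->
  idunkl_poly (c *: \sum_(s : 'S_n) msym s p) =
  a *: (c *: \sum_(s : 'S_n) msym s p).
Proof.
move=> Ap; rewrite idunkl_polyZ scalerA mulrC -scalerA; congr (_ *: _).
rewrite (raddf_sum idunkl_poly) scaler_sumr; apply: eq_bigr => s _ /=.
by rewrite msym_idunkl_poly Ap msymZ.
Qed.

End InvertedDunkl.

(** * Ranks of exponents and the joint spectrum *)

Section Rank.
Context {n : nat}.
Implicit Types (i j : 'I_n) (s : 'S_n) (m : 'X_{1..n}).

(** The stable decreasing sort: larger exponents come first, ties are broken by position. [mrank] is
    then the zero-based place of [j] in the decreasing rearrangement. *)
Definition mprec m i j := (m j < m i)%N || ((m j == m i) && (i < j)%N).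
Definition mrank m j : nat := #|[set i | mprec m i j]|.
Definition mperm m s : 'X_{1..n} := [multinom m (s i) | i < n].

Lemma mprec_irr m i : mprec m i i = false.
Proof. by rewrite /mprec !ltnn andbF. Qed.

Lemma mprec_trans m : transitive (mprec m).
Proof. by rewrite /mprec => j i l; lia. Qed.

Lemma mprec_total m i j : i != j -> ~~ mprec m i j -> mprec m j i.
Proof. by rewrite /mprec -(inj_eq val_inj) /=; lia. Qed.

Lemma ltn_mrank m i j : mprec m i j -> (mrank m i < mrank m j)%N.
Proof.
move=> ij; apply: proper_card; apply/properP; split.
  by apply/subsetP => l; rewrite !inE => /mprec_trans; apply.
by exists i; rewrite !inE ?mprec_irr.
Qed.

Lemma mrank_lt m j : (mrank m j < n)%N.
Proof.
rewrite -[X in (_ < X)%N]card_ord -cardsT; apply/proper_card/properP.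
by split; [exact: subsetT | exists j; rewrite ?inE ?mprec_irr].
Qed.

Lemma mrank_inj m : injective (mrank m).
Proof.
move=> i j rij; apply/eqP; apply: contraT => ij.
have [/ltn_mrank|/(mprec_total _ _ _ ij) /ltn_mrank] := boolP (mprec m i j);
  by rewrite rij ltnn.
Qed.

Lemma mrank_perm m m' s :
  (forall i j, mprec m' i j = mprec m (s i) (s j)) ->
  forall j, mrank m' j = mrank m (s j).
Proof.
move=> Hs j; rewrite /mrank -!sum1dep_card [RHS](reindex_inj (@perm_inj _ s)) /=.
by apply: eq_bigl => i; rewrite Hs.
Qed.

Lemma tperm_adj_ltn (a b i j : 'I_n) : b = a.+1 :> nat ->
  ~~ ((i == a) && (j == b)) -> ~~ ((i == b) && (j == a)) ->
  (tperm a b i < tperm a b j)%N = (i < j)%N.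
Proof.
move=> ba; rewrite -!(inj_eq val_inj) /=.
case: tpermP => [->|->|/eqP ia /eqP ib]; case: tpermP => [->|->|/eqP ja /eqP jb];
  move: ia ib ja jb || move: ia ib || move: ja jb || idtac;
  by rewrite -?(inj_eq val_inj) /= ?ba; lia.
Qed.

(** Only the pair [a], [b] changes its relative position, and its exponents differ, so no tie is
    affected. *)
Lemma mprec_mperm_adj m (a b : 'I_n) : b = a.+1 :> nat -> m a != m b ->
  forall i j, mprec (mperm m (tperm a b)) i j =
    mprec m (tperm a b i) (tperm a b j).
Proof.
move=> ba mab i j; rewrite /mprec !mnmE; congr (_ || _).
have [e|//] := eqVneq (m (tperm a b j)) (m (tperm a b i)).
rewrite /= tperm_adj_ltn //; apply/negP => /andP[/eqP ei /eqP ej]; move: e;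
  by rewrite ei ej tpermL tpermR => e; move: mab; rewrite e eqxx.
Qed.

End Rank.

Section Spectrum.
Context {K : numFieldType} {n : nat} (k : K) (k_ge0 : 0 <= k).
Implicit Types (i j : 'I_n) (s : 'S_n) (m : 'X_{1..n}).

Definition meig m j : K := (m j)%:R - k * (mrank m j)%:R.

Lemma meig_perm m m' s :
  (forall i j, mprec m' i j = mprec m (s i) (s j)) ->
  (forall j, m' j = m (s j)) -> forall j, meig m' j = meig m (s j).
Proof. by move=> Hp Hm j; rewrite /meig Hm (mrank_perm _ _ _ Hp). Qed.

(** A larger exponent has a smaller rank: the exponents contribute at least 1 and the ranks at least
    k. *)
Lemma meig_gap m i j : (m j < m i)%N -> k < meig m i - meig m j.
Proof.
move=> mij; have pij : mprec m i j by rewrite /mprec mij.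
have -> : meig m i - meig m j =
    (m i - m j)%N%:R + k * (mrank m j - mrank m i)%N%:R.
  rewrite /meig (natrB _ (ltnW mij)) (natrB _ (ltnW (ltn_mrank _ _ _ pij))).
  ring.
rewrite -{1}[k]add0r ltr_leD ?ltr0n ?subn_gt0 //.
by rewrite ler_peMr // ler1n subn_gt0 ltn_mrank.
Qed.

Lemma mprec_meig m i j : 0 < k -> i != j -> mprec m i j = (meig m j < meig m i).
Proof.
move=> k_gt0.
have H a b : mprec m a b -> meig m b < meig m a.
  move=> pab; rewrite /meig ltrBlDr -addrA -[ltLHS]addr0 ler_ltD //.
    rewrite ler_nat; move: pab; rewrite /mprec; lia.
  by rewrite addrC subr_gt0 ltr_pM2l // ltr_nat ltn_mrank.
move=> ij; have [/H->//|/(mprec_total _ _ _ ij)/H ji] := boolP (mprec m i j).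
by apply/esym/negbTE; rewrite lt_gtF.
Qed.

(** For k > 0 the order of the eigenvalues recovers the ranks, hence the exponents; for k = 0 the
    eigenvalues are the exponents. *)
Lemma meig_inj m m' : (forall j, meig m j = meig m' j) -> m = m'.
Proof.
move=> E; apply/mnmP => j; have := E j; rewrite /meig.
suff [->|->] : mrank m j = mrank m' j \/ k = 0.
- by move/addIr/eqP; rewrite eqr_nat => /eqP.
- by rewrite !mul0r !subr0 => /eqP; rewrite eqr_nat => /eqP.
move: k_ge0; rewrite le_eqVlt => /orP[/eqP<-|k_gt0]; [by right|left].
apply: eq_card => i; rewrite !inE; have [->|ij] := eqVneq i j.
  by rewrite !mprec_irr.
by rewrite !mprec_meig // !E.
Qed.

End Spectrum.

(** * Joint eigenvectors built by adjacent exchanges and rotation *)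

Section JackRecursion.
Context {K : numFieldType}.

(** This is (-1)^|m| [mu]_{m_+} without sorting: the rank of [j] stands for its place in m_+.
    Invariance under rank-preserving permutations and growth by one factor become immediate. *)
Definition mpoch {n} (k mu : K) (m : 'X_{1..n}) : K :=
  \prod_j ((-1) ^+ m j * \prod_(l < m j) (mu - k * (mrank m j)%:R + l%:R)).

Lemma mpoch_perm n (k mu : K) (m m' : 'X_{1..n}) (s : 'S_n) :
  (forall i j, mprec m' i j = mprec m (s i) (s j)) ->
  (forall j, m' j = m (s j)) -> mpoch k mu m' = mpoch k mu m.
Proof.
move=> Hp Hm; rewrite /mpoch [RHS](reindex_inj (@perm_inj _ s)) /=.
by apply: eq_bigr => j _; rewrite Hm (mrank_perm _ _ _ Hp).
Qed.

Definition jack_eigen {n} (k mu : K) (m : 'X_{1..n}) (F : {mpoly K[n]}) :=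
  [/\ F != 0, forall j, mcherednik k j F = meig k m j *: F &
      idunkl_poly k mu F = mpoch k mu m *: F].

Lemma jack_eigen0 n (k mu : K) : jack_eigen k mu (0%MM : 'X_{1..n}) 1.
Proof.
split; first exact: oner_neq0.
- move=> j; rewrite mcherednikE mdunklXX mdunkl1 mulr0 add0r.
  have H (P : pred 'I_n) :
      \sum_(i | P i) msym (tperm j i) (1 : {mpoly K[n]}) = #|P|%:R *: 1.
    rewrite (eq_bigr (fun=> 1)) => [|i _]; last by rewrite msym1.
    by rewrite sumr_const scaler_nat.
  rewrite !H (eq_card (B := predC1 j)) // cardC1 card_ord.
  (* All exponents are tied at 0, so the rank is the position. *)
  have -> : #|fun i : 'I_n => (i < j)%N| = mrank 0%MM j.
    rewrite /mrank cardsE; apply: eq_card => i.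
    by rewrite !unfold_in /mprec !mnm0E ltnn eqxx.
  rewrite /meig mnm0E -{1}[1]scale1r !scalerA -scalerDl -!scalerBl.
  congr (_ *: _); case: n j {H} => [[]//|n'] j; rewrite /= -[n'.+1%:R]natr1.
  by ring.
by rewrite idunkl_poly1 /mpoch big1 ?scale1r // => j _; rewrite mnm0E big_ord0 mulr1.
Qed.

(** The degenerate affine Hecke relation. Swapping two neighbours moves a single reflection, the one
    exchanging them, in or out of the sum of [mcherednikE]. *)
Lemma mcherednik_adj n (k : K) (a b j : 'I_n) (p : {mpoly K[n]}) : b = a.+1 :> nat ->
  mcherednik k j (msym (tperm a b) p) =
  msym (tperm a b) (mcherednik k (tperm a b j) p)
  + (k * ((j == a)%:R - (j == b)%:R)) *: p.
Proof.
move=> ba; set s := tperm a b; have ab : a != b.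
  by rewrite -(inj_eq val_inj) /= ba; lia.
suff H j' : mcherednik k (s j') (msym s p) =
    msym s (mcherednik k j' p) + (k * ((j' == b)%:R - (j' == a)%:R)) *: p.
  rewrite -{1}[j](tpermK a b) H; congr (_ + (k * (_ - _)) *: p); congr _%:R.
    by rewrite -{2}(tpermL a b) (inj_eq perm_inj).
  by rewrite -{2}(tpermR a b) (inj_eq perm_inj).
rewrite mcherednik_msym mcherednikE.
have -> : \sum_(i < n | (s i < s j')%N) msym (tperm j' i) p =
    \sum_(i < n | (i < j')%N) msym (tperm j' i) p
    + ((j' == a)%:R - (j' == b)%:R) *: msym s p.
  have [ja|ja] := eqVneq j' a.
    rewrite ja (negPf ab) subr0 scale1r (bigD1 b) /=; last first.
      by rewrite /s tpermL tpermR ba.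
    rewrite addrC; congr (_ + _); apply: eq_bigl => i.
    rewrite /s tpermL -(inj_eq val_inj) /= ba.
    by case: tpermP => [->|->|/eqP + /eqP]; rewrite -?(inj_eq val_inj) /= ?ba; lia.
  have [jb|jb] := eqVneq j' b.
    rewrite jb sub0r scaleN1r [in RHS](bigD1 a) /=; last by rewrite ba.
    rewrite tpermC addrC addrK; apply: eq_bigl => i.
    rewrite /s tpermR -(inj_eq val_inj) /= ba.
    by case: tpermP => [->|->|/eqP + /eqP]; rewrite -?(inj_eq val_inj) /= ?ba; lia.
  rewrite subrr scale0r addr0; apply: eq_bigl => i.
  by apply: tperm_adj_ltn => //; rewrite (negPf ja, negPf jb) andbF.
suff -> : (k * ((j' == b)%:R - (j' == a)%:R)) *: p =
    - msym s (k *: (((j' == a)%:R - (j' == b)%:R) *: msym s p)).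
  by rewrite -msymB scalerDr opprD addrA.
rewrite !msymZ /s msym_tpermK scalerA -scaleNr; congr (_ *: _).
by ring.
Qed.

(** The correction term of [mcherednik_adj] is absorbed by adding a multiple of [F]. The eigenvalue
    of [idunkl_poly] survives because that map commutes with permutations. *)
Lemma jack_eigen_adj n (k mu : K) (m : 'X_{1..n}) (a b : 'I_n) F : 0 <= k ->
  b = a.+1 :> nat -> jack_eigen k mu m F ->
  exists F', jack_eigen k mu (mperm m (tperm a b)) F'.
Proof.
move=> k_ge0 ba [F0 DF AF]; have [mab|mab] := eqVneq (m a) (m b).
  exists F; suff -> : mperm m (tperm a b) = m by [].
  by apply/mnmP => i; rewrite mnmE; case: tpermP => [->|->|].
have Hp := mprec_mperm_adj _ _ _ ba mab.
have Hm j : mperm m (tperm a b) j = m (tperm a b j) by rewrite mnmE.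
have ab : a != b by apply: contraNneq mab => ->.
pose d := meig k m b - meig k m a.
have [d0 dk dk'] : [/\ d != 0, d != k & d != - k].
  move: mab; rewrite neq_ltn => /orP[] /(meig_gap _ k_ge0); rewrite -/d => kd.
    have d_gt0 : 0 < d by exact: le_lt_trans kd.
    by split; rewrite ?gt_eqF // (le_lt_trans _ d_gt0) // oppr_le0.
  have kd' : k < - d by rewrite /d opprB.
  have d_lt0 : d < 0 by rewrite -oppr_gt0 (le_lt_trans k_ge0).
  by split; rewrite ?lt_eqF // 1?ltrNr // (lt_le_trans d_lt0).
(* Matching the multiples of [F] in the eigenvalue equation forces c d = k. If the new vector
   vanished, the swap would act on [F] as - c, so c^2 = 1 and d = k or - k, which the gap
   excludes. *)
pose c := k / d.
exists (msym (tperm a b) F + c *: F); split.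
- apply/eqP => E.
  have sF : msym (tperm a b) F = - (c *: F) by apply/eqP; rewrite -addr_eq0 E.
  have : F = (c * c) *: F.
    rewrite -{1}[F](msym_tpermK a b) sF msymN msymZ sF.
    by rewrite scalerN opprK scalerA.
  move/eqP; rewrite -subr_eq0 -{1}[F]scale1r -scalerBl scaler_eq0 (negPf F0) orbF.
  rewrite subr_eq0 eq_sym -expr2 sqrf_eq1 /c.
  by rewrite !(can2_eq (divfK d0) (mulfK d0)) mul1r mulN1r ![k == _]eq_sym
    (negPf dk) eqr_oppLR (negPf dk').
- move=> j; rewrite mcherednikD mcherednikZ mcherednik_adj // !DF msymZ.
  rewrite (meig_perm _ _ _ _ Hp Hm) -!mul_mpolyC.
  suff -> : k * ((j == a)%:R - (j == b)%:R) =
      c * (meig k m (tperm a b j) - meig k m j).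
    by rewrite !(mpolyCM, mpolyCB); ring.
  rewrite {1}(_ : k = c * d); last by rewrite /c divfK.
  rewrite -mulrA; congr (_ * _); rewrite /d.
  case: tpermP => [->|->|/eqP/negPf-> /eqP/negPf->]; rewrite ?eqxx; last by ring.
    by rewrite (negPf ab) /=; ring.
  by rewrite [b == a]eq_sym (negPf ab) /=; ring.
rewrite idunkl_polyD msym_idunkl_poly AF (mpoch_perm _ _ _ _ _ _ Hp Hm).
by rewrite idunkl_polyZ AF msymZ scalerDr !scalerA [c * _]mulrC.
Qed.

End JackRecursion.

Section JackRotation.
Context {K : numFieldType} {n : nat}.
Implicit Types (k mu : K) (i j l : 'I_n.+1) (m : 'X_{1..n.+1}).

Definition rotS : 'S_n.+1 := perm (can_inj (@ordSK n.+1)).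

Lemma rotSE j : rotS j = (if j == n :> nat then 0 else j.+1)%N :> nat.
Proof.
rewrite permE /=; have := ltn_ord j; rewrite ltnS leq_eqVlt.
case: eqP => [->|_] /= jn; first by rewrite modnn.
by rewrite modn_small.
Qed.

Lemma rotSVE j : (rotS^-1)%g j = (if j == ord0 then n else j.-1)%N :> nat.
Proof.
have := rotSE ((rotS^-1)%g j); rewrite permKV -(inj_eq val_inj) /=.
by have := ltn_ord ((rotS^-1)%g j); case: eqVneq => [->|_] _ ->.
Qed.

(** On exponents, the Knop-Sahi raising operator: (m_0, ..., m_n) becomes (m_1, ..., m_n, m_0 +
    1). *)
Definition mphi m : 'X_{1..n.+1} :=
  [multinom (m (rotS j) + (rotS j == ord0))%N | j < n.+1].

(** The first entry wins ties by its position; moved to the end it wins the same comparisons because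
    it has grown by 1. *)
Lemma mprec_mphi m i j : mprec (mphi m) i j = mprec m (rotS i) (rotS j).
Proof.
rewrite /mprec !mnmE -!(inj_eq val_inj) /= !rotSE.
have := ltn_ord i; have := ltn_ord j.
have [ei|ei] := eqVneq (i : nat) n; have [ej|ej] := eqVneq (j : nat) n => /=.
- by rewrite (_ : i = j); [lia | apply: val_inj; rewrite /= ei ej].
- lia.
- lia.
- lia.
Qed.

Lemma mdeg_mphi m : mdeg (mphi m) = (mdeg m).+1.
Proof.
have -> : mdeg (mphi m) = (\sum_j (m j + (j == ord0)))%N.
  rewrite mdegE [RHS](reindex_inj (@perm_inj _ rotS)) /=.
  by apply: eq_bigr => j _; rewrite mnmE.
rewrite big_split /= -mdegE -[RHS]addn1; congr (_ + _)%N.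
by rewrite (bigD1 ord0) //= big1 // => j /negPf->.
Qed.

Lemma mphi_surj m : m ord_max != 0%N -> exists m', m = mphi m'.
Proof.
move=> m0; exists [multinom (m ((rotS^-1)%g i) - (i == ord0))%N | i < n.+1].
apply/mnmP => j; rewrite !mnmE permK subnK //.
rewrite -(inj_eq val_inj) /= rotSE; case: (eqVneq (j : nat) n) => [jn|//] /=.
by rewrite lt0n (_ : j = ord_max) //; apply: val_inj.
Qed.

Lemma mpoch_mphi k mu m :
  mpoch k mu (mphi m) = - (mu + meig k m ord0) * mpoch k mu m.
Proof.
pose f (i : 'I_n.+1) d : K :=
  (-1) ^+ d * \prod_(l < d) (mu - k * (mrank m i)%:R + l%:R).
have -> : mpoch k mu (mphi m) = \prod_i f i (m i + (i == ord0))%N.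
  rewrite [RHS](reindex_inj (@perm_inj _ rotS)) /=; apply: eq_bigr => j _.
  by rewrite (mrank_perm _ _ _ (mprec_mphi m)) mnmE.
rewrite /mpoch (bigD1 ord0) //= [in RHS](bigD1 ord0) //= mulrA.
congr (_ * _); last by apply: eq_bigr => i /negPf->; rewrite addn0.
by rewrite /f addn1 exprS big_ord_recr /= /meig; ring.
Qed.

(** For [l] = 0 the reflections from [mdunklXX] cancel the sum, which after rotation contains every
    other index. Otherwise the rotation removes the index 0 from the sum, and the lost reflection
    reappears when ['X_ord0] is pulled through the Dunkl operator. *)
Lemma mcherednik_rot k l (p : {mpoly K[n.+1]}) :
  mcherednik k ((rotS^-1)%g l) (msym (rotS^-1) ('X_ord0 * p)) =
  msym (rotS^-1) ('X_ord0 * (mcherednik k l p + (l == ord0)%:R *: p)).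
Proof.
rewrite mcherednik_msym; congr (msym _ _); rewrite mcherednikE.
have [->|l0] := eqVneq l ord0.
  rewrite mdunklXX.
  have -> : \sum_(i < n.+1 | (i < (ord0 : 'I_n.+1))%N) msym (tperm ord0 i) p = 0.
    exact: big_pred0.
  rewrite scaler0 subr0 scale1r.
  have -> : \sum_(i < n.+1 | ((rotS^-1)%g i < (rotS^-1)%g ord0)%N)
        msym (tperm ord0 i) ('X_ord0 * p) =
      \sum_(i < n.+1 | i != ord0) msym (tperm ord0 i) ('X_ord0 * p).
    apply: eq_bigl => i; rewrite !rotSVE eqxx.
    case: eqVneq => /= [_|]; first by rewrite ltnn.
    by rewrite -(inj_eq val_inj) /=; have := ltn_ord i; lia.
  by rewrite -!mul_mpolyC; ring.
rewrite scale0r addr0 (mulrCA 'X_l) (mdunklX k l ord0); last by rewrite eq_sym.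
rewrite msymM msymXU tpermL [in RHS](bigD1 ord0) /=; last by rewrite lt0n.
have -> : \sum_(i < n.+1 | ((rotS^-1)%g i < (rotS^-1)%g l)%N)
      msym (tperm l i) ('X_ord0 * p) =
    'X_ord0 * \sum_(i < n.+1 | (i < l)%N && (i != ord0)) msym (tperm l i) p.
  rewrite mulr_sumr; apply: eq_big => [i|i].
    rewrite !rotSVE (negPf l0); case: eqVneq => [->|i0]; first by have := ltn_ord l; lia.
    by move: l0 i0; rewrite -!(inj_eq val_inj) /=; lia.
  rewrite !rotSVE (negPf l0); case: eqVneq => [->|i0 _].
    by have := ltn_ord l; lia.
  by rewrite msymM msymXU tpermD.
by rewrite scalerDr -!mul_mpolyC; ring.
Qed.

Lemma jack_eigen_phi k mu m F : jack_eigen k mu m F ->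
  jack_eigen k mu (mphi m) (msym (rotS^-1) ('X_ord0 * F)).
Proof.
case=> F0 DF AF; split.
- apply: contraNneq F0; rewrite -[in X in X -> _](msym0 K (rotS^-1)%g) => /inj_msym/eqP.
  rewrite mulf_eq0 => /orP[/eqP/(congr1 (mcoeff U_(ord0)))/eqP|].
    by rewrite mcoeffXU eqxx mcoeff0 oner_eq0.
  by [].
- move=> j; have := mcherednik_rot k (rotS j) F; rewrite permK => ->; rewrite DF.
  rewrite -scalerDl -scalerAr msymZ; congr (_ *: _).
  by rewrite /meig (mrank_perm _ _ _ (mprec_mphi m)) mnmE natrD; ring.
rewrite msym_idunkl_poly idunkl_polyM AF linearZ /= msymZ mpoch_mphi.
rewrite -msymZ idunkl.unlock.
(* The eigenvalue equation at the first index has no reflections left, so it expresses the Dunkl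
   operator applied to ['X_ord0 * F] as a multiple of [F]. *)
have := DF ord0; rewrite mcherednikE (big_pred0 _ _ _ _ (fun i => ltn0 i)) scaler0 subr0.
move/eqP; rewrite subr_eq => /eqP ->.
rewrite -msymZ; congr (msym _ _); rewrite -!mul_mpolyC.
by rewrite !(mpolyCM, mpolyCD, mpolyCN, mpolyCB) ?mpolyC1; ring.
Qed.

End JackRotation.

(** Induction on the degree, then on the distance of a nonzero exponent from the end: adjacent swaps
    carry it to the last place, where [mphi] can be undone and the degree drops. *)
Lemma jack_eigen_exists {K : numFieldType} n (k mu : K) (m : 'X_{1..n}) : 0 <= k ->
  exists F, jack_eigen k mu m F.
Proof.
move=> k_ge0; case: n m => [|n] m.
  by exists 1; rewrite (_ : m = 0%MM); [exact: jack_eigen0 | apply/mnmP => -[]].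
have [d] := ubnP (mdeg m); elim: d m => // d IH m; rewrite ltnS => le_md.
have [i mi|m0] := pickP (fun i => m i != 0%N); last first.
  exists 1; rewrite (_ : m = 0%MM); first exact: jack_eigen0.
  by apply/mnmP => i; rewrite mnm0E; apply/eqP; rewrite -[_ == _]negbK m0.
have [c] := ubnP (n - i); elim: c => // c IHc in m i mi le_md *; rewrite ltnS => le_ic.
have [ei|ni] := eqVneq i ord_max.
  move: mi; rewrite ei => /mphi_surj[m' em]; move: le_md.
  rewrite em mdeg_mphi => /IH[F] /jack_eigen_phi; eauto.
have lt_in : (i < n)%N.
  by have := ltn_ord i; move: ni; rewrite -(inj_eq val_inj) /=; lia.
pose b := Ordinal (lt_in : (i.+1 < n.+1)%N); pose s := tperm i b.
have [||//|F] := IHc (mperm m s) b.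
- by rewrite mnmE tpermR.
- by rewrite mdeg_mperm.
- by rewrite /= subnS; lia.
case/(jack_eigen_adj _ _ _ _ i b _ k_ge0 erefl) => F' HF'; exists F'.
rewrite (_ : m = mperm (mperm m s) s) //.
by apply/mnmP => j; rewrite !mnmE tpermK.
Qed.

(** * Triangularity of the Cherednik operators and uniqueness of eigenvectors *)

Section Triangularity.
Context {K : idomainType} {n : nat}.
Implicit Types (i j : 'I_n) (m : 'X_{1..n}) (p q : {mpoly K[n]}).

(* Strictly decreases when two exponents move closer together, and when the
   larger of two exponents moves to a later position. *)
Definition mspread m : nat := \sum_i (n * m i + (n.-1 - i)) ^ 2.

Definition mshift m j i l : 'X_{1..n} :=
  [multinom if c == j then (m j - l)%N else if c == i then (m i + l)%N else m c
  | c < n].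

Lemma mshift_tperm m j i : i != j -> (m i <= m j)%N ->
  mshift m j i (m j - m i) = mperm m (tperm j i).
Proof.
move=> ij mij; apply/mnmP => c; rewrite !mnmE.
case: tpermP => [->|->|/eqP/negPf-> /eqP/negPf->//]; first by rewrite eqxx subKn.
by rewrite (negPf ij) eqxx subnKC.
Qed.

(** With X, Y, L as below, the old squares are those of X + L and Y, the new ones those of X and Y +
    L. The difference 2 L (X - Y) is positive: either n times the gap of exponents outweighs the
    positions, or the positions decide. *)
Lemma mspread_mshift m j i l : i != j -> (0 < l)%N -> (m i + l <= m j)%N ->
  (m i + l < m j)%N || (j < i)%N -> (mspread (mshift m j i l) < mspread m)%N.
Proof.
move=> ij l0 ml mlt; rewrite /mspread (bigD1 j) //= (bigD1 i) //=.
rewrite [ltnRHS](bigD1 j) //= [in ltnRHS](bigD1 i) //= !addnA.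
rewrite (eq_bigr (fun c : 'I_n => (n * m c + (n.-1 - c)) ^ 2))%N; last first.
  by move=> c /andP[cj ci]; rewrite mnmE (negPf cj) (negPf ci).
rewrite ltn_add2r !mnmE eqxx (negPf ij) eqxx mulnBr mulnDr.
have jn := ltn_ord j; have in_ := ltn_ord i.
have H : (n * m i + n * l + (n.-1 - i) < n * m j + (n.-1 - j))%N.
  rewrite -mulnDr; case/orP: mlt => [lt|ji].
    have := leq_mul (leqnn n) lt; rewrite mulnS; lia.
  have := leq_mul (leqnn n) ml; lia.
have nl : (0 < n * l)%N by rewrite muln_gt0 l0 (leq_trans _ jn).
have nlj : (n * l <= n * m j)%N by rewrite leq_mul2l; lia.
move: H nl nlj; set A := (n * m j)%N; set B := (n * m i)%N; set L := (n * l)%N.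
set a := (n.-1 - i)%N; set b := (n.-1 - j)%N => H nl nlj.
have [X AX] : exists X, (A - L + b)%N = X by eexists.
have [Y BY] : exists Y, (B + a)%N = Y by eexists.
have -> : (A + b)%N = (X + L)%N by lia.
have -> : (B + L + a)%N = (Y + L)%N by lia.
have : (Y * L < X * L)%N by rewrite ltn_pmul2r //; lia.
by rewrite AX BY !sqrnD; lia.
Qed.

(** The finite geometric sum, peeled off one factor ['X_j] at a time. *)
Lemma mddiff_mono m j i : i != j -> (m i <= m j)%N ->
  'X_j * mddiff j i 'X_[m] =
  \sum_(l < m j - m i) 'X_[mshift m j i l] :> {mpoly K[n]}.
Proof.
move=> ij; have ji : j != i by rewrite eq_sym.
move: {2}(m j - m i)%N (erefl (m j - m i)%N) => d; elim: d m => [|d IH] m md mij.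
  have mE : m i = m j by lia.
  rewrite md big_ord0 (mddiff_unique _ _ _ 0 ji) ?mulr0 //.
  apply/esym/eqP; rewrite subr_eq0 msymX tpermV; apply/eqP; congr 'X_[_].
  by apply/mnmP => c; rewrite mnmE; case: tpermP => [->|->|].
have [m' mE] : exists m', m = (U_(j) + m')%MM.
  by exists (m - U_(j))%MM; rewrite addmC submK // lep1mP; lia.
have mj : m j = (m' j).+1 by rewrite mE mnmDE mnm1E eqxx.
have mc c : c != j -> m c = m' c.
  by move=> cj; rewrite mE mnmDE mnm1E eq_sym (negPf cj).
have mi := mc i ij.
rewrite {1}mE mpolyXD mddiffX // eqxx (negPf ji) subr0 mul1r mulrDr.
rewrite IH; [|lia..].
have -> : (m' j - m' i)%N = d by lia.
rewrite md big_ord_recr mulr_sumr msymX -mpolyXD tpermV /=.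
congr (_ + _); last first.
  congr 'X_[_]; apply/mnmP => c; rewrite mnmDE mnm1E !mnmE.
  case: tpermP => [->|->|/eqP cj /eqP/negPf->].
  - by rewrite eqxx; lia.
  - by rewrite (negPf ij) eqxx (negPf ji); lia.
  - by rewrite [j == c]eq_sym (negPf cj) mc.
apply: eq_bigr => l _; rewrite -mpolyXD; congr 'X_[_]; apply/mnmP => c.
rewrite mnmDE mnm1E !mnmE; have := ltn_ord l.
case: (eqVneq c j) => [_|cj]; first by lia.
by rewrite mi => _; case: ifP => // _; rewrite mc.
Qed.

Definition mlower m p := forall m', (mspread m <= mspread m')%N -> p@_m' = 0.

Lemma mlower0 m : mlower m 0.
Proof. by move=> m' _; rewrite mcoeff0. Qed.

Lemma mlowerN m p : mlower m p -> mlower m (- p).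
Proof. by move=> Hp m' /Hp; rewrite mcoeffN => ->; rewrite oppr0. Qed.

Lemma mlowerD m p q : mlower m p -> mlower m q -> mlower m (p + q).
Proof. by move=> Hp Hq m' le; rewrite mcoeffD Hp // Hq // addr0. Qed.

Lemma mlower_sum (I : Type) (r : seq I) (P : pred I) (F : I -> {mpoly K[n]}) m :
  (forall t, P t -> mlower m (F t)) -> mlower m (\sum_(i <- r | P i) F i).
Proof.
move=> HF m' le; rewrite (raddf_sum (mcoeff m')) big1 // => t Pt.
exact: HF.
Qed.

Lemma mlowerX m m' : (mspread m' < mspread m)%N -> mlower m 'X_[m'].
Proof.
move=> lt m1 le; rewrite mcoeffX; case: eqVneq => // e.
by move: lt; rewrite e ltnNge le.
Qed.

(** The share of the index [i] in the action on a monomial; the subtracted ['X_[m]] is its share of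
    the constant k (1 - n). The diagonal coefficient that remains is -1 when [i] precedes [j] and 0
    otherwise, hence the rank in the eigenvalue. *)
Lemma mlower_mddiff m j i : i != j ->
  mlower m ('X_j * mddiff j i 'X_[m]
    + (if (j < i)%N then msym (tperm j i) 'X_[m] else 0) - 'X_[m]
    + (mprec m i j)%:R *: 'X_[m]).
Proof.
move=> ij; have ji : j != i by rewrite eq_sym.
have sX : msym (tperm j i) 'X_[m] = 'X_[mperm m (tperm j i)] :> {mpoly K[n]}.
  by rewrite msymX tpermV.
have nij : (i < j)%N = ~~ (j < i)%N.
  by rewrite -leqNgt ltn_neqAle; move: ij; rewrite -(inj_eq val_inj) /= => ->.
have sE : (m i <= m j)%N -> mperm m (tperm j i) = mshift m j i (m j - m i).
  by move=> mij; rewrite mshift_tperm.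
case: (ltngtP (m i) (m j)) => mij.
- have -> : mprec m i j = false by rewrite /mprec; lia.
  rewrite scale0r addr0 mddiff_mono ?(ltnW mij) //.
  case E : (m j - m i)%N => [|d]; first by lia.
  rewrite big_ord_recl /=; have -> : mshift m j i 0 = m.
    apply/mnmP => c; rewrite mnmE subn0 addn0.
    by case: eqP => [->//|_]; case: eqP => [->//|_].
  set T := \sum_(_ < d) _; set S := if _ then _ else _.
  rewrite (_ : _ - _ = T + S); last by ring.
  apply: mlowerD.
    apply: mlower_sum => l _; apply/mlowerX/mspread_mshift => //.
      by have := ltn_ord l; rewrite /bump /=; lia.
    by have := ltn_ord l; rewrite /bump /=; lia.
  rewrite /S; case: ifP => [ji'|_]; last exact: mlower0.
  rewrite sX sE ?(ltnW mij) //; apply/mlowerX/mspread_mshift => //.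
  - by rewrite subn_gt0.
  - by rewrite subnKC // ltnW.
  - by rewrite ji' orbT.
- have -> : mprec m i j = true by rewrite /mprec mij.
  (* Antisymmetry reduces to the other order of exponents. The term l = 0 is now the swapped
     monomial: for j < i the reflection cancels it, for i < j it has smaller spread. *)
  have -> : 'X_j * mddiff j i 'X_[m] =
      - \sum_(l < m i - m j) 'X_[mshift m i j (m i - m j - l)] :> {mpoly K[n]}.
    rewrite -['X_[m]](msym_tpermK j i) mddiff_tperm mulrN sX; congr (- _).
    rewrite mddiff_mono ?mnmE ?tpermL ?tpermR ?(ltnW mij) //.
    apply: eq_bigr => l _; congr 'X_[_]; apply/mnmP => c; rewrite !mnmE.
    rewrite tpermL tpermR; have := ltn_ord l.
    have [->|cj] := eqVneq c j; first by rewrite (negPf ji); lia.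
    have [_|ci] := eqVneq c i; first by lia.
    by rewrite tpermD // eq_sym.
  case E : (m i - m j)%N => [|d]; first by lia.
  rewrite big_ord_recl /= subn0 -E.
  have sE' : mshift m i j (m i - m j) = mperm m (tperm j i).
    by rewrite mshift_tperm ?(ltnW mij) // tpermC.
  set T := \sum_(_ < d) _; rewrite sE' scale1r -addrA addNr addr0.
  have lT : mlower m (- T).
    apply/mlowerN/mlower_sum => l _; apply/mlowerX/mspread_mshift => //;
      by have := ltn_ord l; rewrite /bump /=; lia.
  case: ifP => ji'.
    by rewrite sX (_ : _ + _ = - T) //; ring.
  rewrite addr0 opprD; apply: mlowerD => //; apply/mlowerN.
  rewrite -sE'; apply/mlowerX/mspread_mshift => //.
  - by rewrite subn_gt0.
  - by rewrite subnKC // ltnW.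
  - by rewrite nij ji' orbT.
have -> : mprec m i j = (i < j)%N by rewrite /mprec mij ltnn eqxx.
rewrite mddiff_mono ?mij // subnn big_ord0 add0r sX.
have -> : mperm m (tperm j i) = m.
  by apply/mnmP => c; rewrite mnmE; case: tpermP => [->|->|].
rewrite nij; case: (j < i)%N; rewrite ?subrr ?sub0r ?scale0r ?scale1r ?addNr ?addr0;
  exact: mlower0.
Qed.

End Triangularity.

Section Uniqueness.
Context {K : numFieldType} {n : nat} (k : K) (k_ge0 : 0 <= k).
Implicit Types (i j : 'I_n) (m : 'X_{1..n}) (p q : {mpoly K[n]}).

Lemma mcherednik_mono j m :
  mlower m (mcherednik k j 'X_[m] - meig k m j *: 'X_[m]).
Proof.
pose G i : {mpoly K[n]} := 'X_j * mddiff j i 'X_[m]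
    + (if (j < i)%N then msym (tperm j i) 'X_[m] else 0) - 'X_[m]
    + (mprec m i j)%:R *: 'X_[m].
suff -> : mcherednik k j 'X_[m] - meig k m j *: 'X_[m] =
    k *: \sum_(i | i != j) G i.
  rewrite scaler_sumr; apply: mlower_sum => i ij m' le.
  by rewrite mcoeffZ (mlower_mddiff m j i ij) ?mulr0.
rewrite /G !big_split /= sumrN -mulr_sumr -scaler_suml sumr_const.
rewrite (eq_card (B := predC1 j)) // cardC1 card_ord.
have -> : \sum_(i | i != j) (if (j < i)%N then msym (tperm j i) 'X_[m] else 0) =
    \sum_(i < n | (j < i)%N) msym (tperm j i) 'X_[m] :> {mpoly K[n]}.
  rewrite -big_mkcondr /=; apply: eq_bigl => i.
  by rewrite -(inj_eq val_inj) /=; case: ltngtP.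
have -> : \sum_(i | i != j) (mprec m i j)%:R = (mrank m j)%:R :> K.
  have -> : mrank m j = (\sum_(i | i != j) mprec m i j)%N.
    rewrite /mrank -sum1dep_card big_mkcond [RHS]big_mkcond /=.
    apply: eq_bigr => i _; have [->|_] := eqVneq i j; first by rewrite mprec_irr.
    by case: mprec.
  by rewrite natr_sum.
rewrite mcherednik.unlock mdunkl.unlock mderivX mulrDr -scalerAr.
have -> : (m j)%:R *: ('X_j * 'X_[m - U_(j)]) = (m j)%:R *: 'X_[m] :> {mpoly K[n]}.
  have [->|mj] := eqVneq (m j) 0%N; first by rewrite !scale0r.
  by rewrite -mpolyXD addmC submK // lep1mP.
have -> : (1 - n%:R) = - n.-1%:R :> K.
  by rewrite -subn1 natrB ?opprB // (leq_trans _ (ltn_ord j)).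
rewrite -scaler_nat /meig -!mul_mpolyC !(mpolyCM, mpolyCB, mpolyCN).
by ring.
Qed.

(** Other monomials of the same spread do not interfere, since [mlower] excludes them as well. *)
Lemma mcoeff_mcherednik j p m :
  (forall m', m' \in msupp p -> (mspread m' <= mspread m)%N) ->
  (mcherednik k j p)@_m = meig k m j * p@_m.
Proof.
move=> Hm; rewrite {1}[p]mpolyE (raddf_sum (mcherednik k j)).
rewrite (raddf_sum (mcoeff m)) /=.
have -> : meig k m j * p@_m = \sum_(m' <- msupp p) p@_m' * (meig k m' j * (m' == m)%:R).
  have [mp|mp] := boolP (m \in msupp p).
    rewrite (bigD1_seq m) ?msupp_uniq //= eqxx mulr1 mulrC big1 ?addr0 // => m' /negPf->.
    by rewrite !mulr0.
  rewrite (memN_msupp_eq0 mp) mulr0 big_seq big1 // => m' m'p.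
  by case: eqVneq mp => [<-|_]; rewrite ?m'p ?mulr0.
apply: eq_big_seq => m' m'p; rewrite mcherednikZ mcoeffZ; congr (_ * _).
have /eqP := mcherednik_mono j m' m (Hm _ m'p).
by rewrite mcoeffB mcoeffZ mcoeffX subr_eq0 => /eqP.
Qed.

(** At a monomial of maximal spread in the support the operators act diagonally; the eigenvalues
    found there must be those of [m], so that monomial is [m]. *)
Lemma mcherednik_eigen_neq0 m p : p != 0 ->
  (forall j, mcherednik k j p = meig k m j *: p) -> p@_m != 0.
Proof.
move=> p0 Dp; have [m1 m1p Hm1] : exists2 m1, m1 \in msupp p &
    forall m', m' \in msupp p -> (mspread m' <= mspread m1)%N.
  move: p0; rewrite -msupp_eq0; elim: (msupp p) => // a [|b s] IH _.
    by exists a => [|m']; rewrite !inE // => /eqP->.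
  have [//|c cs Hc] := IH; have [ac|ca] := leqP (mspread a) (mspread c).
    exists c => [|m']; rewrite in_cons ?cs ?orbT //.
    by case/orP=> [/eqP->//|/Hc].
  exists a => [|m']; first by rewrite in_cons eqxx.
  by rewrite in_cons; case/orP=> [/eqP->//|/Hc/leq_trans->//]; exact: ltnW.
suff -> : m = m1 by rewrite -mcoeff_msupp.
apply/esym/(meig_inj k k_ge0) => j; have := congr1 (mcoeff m1) (Dp j).
rewrite mcoeff_mcherednik // mcoeffZ; apply/mulIf.
by rewrite -mcoeff_msupp.
Qed.

(** Subtracting the multiple of the constructed eigenvector with the same coefficient at [m] leaves
    a joint eigenvector whose coefficient there is 0, so it vanishes. *)
Lemma idunkl_poly_eigen mu m p :
  (forall j, mcherednik k j p = meig k m j *: p) ->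
  idunkl_poly k mu p = mpoch k mu m *: p.
Proof.
move=> Dp; have [F [F0 DF AF]] := jack_eigen_exists n k mu m k_ge0.
have Fm := mcherednik_eigen_neq0 _ _ F0 DF.
suff -> : p = (p@_m / F@_m) *: F by rewrite idunkl_polyZ AF !scalerA mulrC.
apply/eqP; rewrite -subr_eq0; apply: contraT => /mcherednik_eigen_neq0 H.
pose q := p - (p@_m / F@_m) *: F.
suff Dq j : mcherednik k j q = meig k m j *: q.
  by have := H _ Dq; rewrite mcoeffB mcoeffZ divfK // subrr eqxx.
rewrite (raddfB (mcherednik k j)) /= mcherednikZ DF Dp.
by rewrite scalerBr !scalerA [meig _ _ _ * _]mulrC.
Qed.

End Uniqueness.

From mathcomp Require Import all_classical all_reals all_analysis.
From mathcomp Require Import complex.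
Local Open Scope ring_scope.
Local Open Scope complex_scope.

(** * Derivatives of complex-valued functions along lines *)

Section ComplexCurves.
Import numFieldNormedType.Exports.
Context {R : realType}.
Local Notation C := R[i].
Implicit Types (f g : R -> C) (t : R) (c d e : C).

Definition is_cderive t f d : Prop :=
  is_derive t (1 : R) (fun s => complex.Re (f s)) (complex.Re d) /\
  is_derive t (1 : R) (fun s => complex.Im (f s)) (complex.Im d).

Lemma is_cderive_cst t c : is_cderive t (fun=> c) 0.
Proof. by split; exact: is_derive_cst. Qed.

Lemma is_cderive_real t (f : R -> R) (d : R) :
  is_derive t (1 : R) f d -> is_cderive t (fun s => (f s)%:C) d%:C.
Proof. by move=> df; split => //=; exact: is_derive_cst. Qed.

Lemma is_cderiveD t f g d e : is_cderive t f d -> is_cderive t g e ->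
  is_cderive t (fun s => f s + g s) (d + e).
Proof.
move=> [fr fi] [gr gi]; split.
  have := is_deriveD fr gr; rewrite (raddfD (@complex.Re R)).
  by congr is_derive; apply/funext => s; rewrite fctE raddfD.
have := is_deriveD fi gi; rewrite (raddfD (@complex.Im R)).
by congr is_derive; apply/funext => s; rewrite fctE raddfD.
Qed.

Lemma is_cderiveM t f g d e : is_cderive t f d -> is_cderive t g e ->
  is_cderive t (fun s => f s * g s) (d * g t + f t * e).
Proof.
move=> [fr fi] [gr gi]; split.
  have := is_deriveB (is_deriveM fr gr) (is_deriveM fi gi).
  congr is_derive; first by apply/funext => s; rewrite !fctE; case: (f s); case: (g s).
  by case: (f t) => a b; case: (g t) => a' b'; case: d {fr fi} => u v;
    case: e {gr gi} => u' v'; rewrite /= /GRing.scale /=; ring.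
have := is_deriveD (is_deriveM fr gi) (is_deriveM fi gr).
congr is_derive; first by apply/funext => s; rewrite !fctE; case: (f s); case: (g s).
by case: (f t) => a b; case: (g t) => a' b'; case: d {fr fi} => u v;
  case: e {gr gi} => u' v'; rewrite /= /GRing.scale /=; ring.
Qed.

Lemma is_cderive_near t f g d : (\forall s \near t, f s = g s) ->
  is_cderive t f d -> is_cderive t g d.
Proof.
move=> fg [fr fi]; split.
  by apply: near_eq_is_derive fr; near=> s; rewrite (near fg s).
by apply: near_eq_is_derive fi; near=> s; rewrite (near fg s).
Unshelve. all: by end_near. Qed.

Lemma is_cderive_cexp t f d : is_cderive t f d ->
  is_cderive t (fun s => cexp (f s)) (d * cexp (f t)).
Proof.
move=> [fr fi].
have er := is_derive1_comp (is_derive_expR (complex.Re (f t))) fr.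
have ci := is_derive1_comp (is_derive_cos (complex.Im (f t))) fi.
have si := is_derive1_comp (is_derive_sin (complex.Im (f t))) fi.
split.
  have := is_deriveM er ci; congr is_derive.
  by case: d {fr fi er ci si} => u v; rewrite /cexp /= /GRing.scale /=; ring.
have := is_deriveM er si; congr is_derive.
by case: d {fr fi er ci si} => u v; rewrite /cexp /= /GRing.scale /=; ring.
Qed.

Lemma is_cderive_meval n t (g : 'I_n -> R -> C) (d : 'I_n -> C) (p : {mpoly C[n]}) :
  (forall i, is_cderive t (g i) (d i)) ->
  is_cderive t (fun s => meval (g^~ s) p)
    (meval_deriv (g^~ t) d p).
Proof.
move=> dg; elim/(@mpoly_indX C): p => [|c p q IHp IHq|l p IHp].
- rewrite (_ : (fun s => _) = fun=> 1); last by apply/funext => s; rewrite meval1.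
  by rewrite meval_deriv1; exact: is_cderive_cst.
- have := is_cderiveD _ _ _ _ _ (is_cderiveM _ _ _ _ _ (is_cderive_cst t c) IHp) IHq.
  congr is_cderive; first by apply/funext => s; rewrite mevalD mevalZ.
  by rewrite meval_deriv_lin mul0r add0r.
have := is_cderiveM _ _ _ _ _ (dg l) IHp.
congr is_cderive; first by apply/funext => s; rewrite mevalM mevalXU.
by rewrite meval_derivX.
Qed.

End ComplexCurves.

Section DirectionalDerivative.
Import numFieldNormedType.Exports.
Context {R : realType} {n : nat}.
Local Notation C := R[i].
Local Notation vec := 'rV[R]_n.
Implicit Types (f : vec -> C) (x v : vec).

(** Reduces directional derivatives to one real variable, where the product and chain rules are
    applied. *)
Lemma derive_line (f : vec -> R) x v :
  'D_v f x = 'D_1 (fun t : R => f (x + t *: v)) 0.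
Proof.
rewrite /derive.
suff -> : (fun h : R => h^-1 *: ((f \o shift x) (h *: v) - f x)) =
    (fun h : R => h^-1 *: (((fun t : R => f (x + t *: v)) \o shift 0) (h *: 1) -
      f (x + 0 *: v))) by [].
apply/funext => h /=.
by rewrite scale0r !addr0 [h *: 1]mulr1 (addrC x).
Qed.

Lemma cderive_line f x v d :
  is_cderive 0 (fun t => f (x + t *: v)) d -> cderive f x v = d.
Proof.
case=> [fr fi]; rewrite /cderive !derive_line.
by rewrite (@derive_val _ _ _ _ _ _ _ fr) (@derive_val _ _ _ _ _ _ _ fi); case: d {fr fi}.
Qed.

Lemma is_derive_line x v (i : 'I_n) :
  is_derive (0 : R) (1 : R) (fun t : R => (x + t *: v) 0 i) (v 0 i).
Proof.
have := is_deriveD (is_derive_cst (x 0 i) (0 : R) (1 : R))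
  (is_deriveM (is_derive_id (0 : R) (1 : R)) (is_derive_cst (v 0 i) (0 : R) (1 : R))).
congr is_derive; first by apply/funext => t; rewrite !fctE !mxE.
by rewrite /= scale0r !add0r /GRing.scale /= mulr1.
Qed.

End DirectionalDerivative.

(** * The power of Delta and its products with polynomials in 1/x *)

Section DeltaPower.
Import numFieldNormedType.Exports.
Context {R : realType} {n : nat}.
Local Notation C := R[i].
Local Notation vec := 'rV[R]_n.
Implicit Types (x v : vec) (mu : C).

Lemma is_derive_prod (F : 'I_n -> R -> R) (d : 'I_n -> R) (t : R) :
  (forall i, is_derive t (1 : R) (F i) (d i)) -> (forall i, F i t != 0) ->
  is_derive t (1 : R) (fun s => \prod_i F i s) (\prod_i F i t * \sum_i d i / F i t).
Proof.
move=> dF F0; elim: (index_enum _) => [|i r IH].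
  rewrite !big_nil mulr0 (_ : (fun s => _) = cst 1); first exact: is_derive_cst.
  by apply/funext => s; rewrite big_nil.
have := is_deriveM (dF i) IH; congr is_derive.
  by apply/funext => s; rewrite big_cons fctE.
by rewrite !big_cons /GRing.scale /=; field; exact: F0.
Qed.

Lemma Delta_line_near x v : (forall i, x 0 i != 0) ->
  \forall t \near (0 : R), 0 < Num.sg (Delta x) * Delta (x + t *: v).
Proof.
move=> x0; have D0 : Delta x != 0 by apply/prodf_neq0.
have dD : is_derive (0 : R) (1 : R) (fun t : R => Delta (x + t *: v))
    (\prod_i (x + 0 *: v) 0 i * \sum_i v 0 i / (x + 0 *: v) 0 i).
  apply: is_derive_prod => i; first exact: is_derive_line.
  by rewrite scale0r addr0.
have cD : {for (0 : R), continuous (fun t : R => Num.sg (Delta x) * Delta (x + t *: v))}.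
  apply: continuousM; first exact: cst_continuous.
  apply: differentiable_continuous; apply/derivable1_diffP.
  exact: (@ex_derive _ _ _ _ _ _ _ dD).
by apply: (cvgr_gt _ cD); rewrite scale0r addr0 -normrEsg normr_gt0.
Qed.

Lemma is_cderive_Delta_pow mu x v : (forall i, x 0 i != 0) ->
  is_cderive 0 (fun t => Delta_pow mu (x + t *: v))
    (- mu * (\sum_i v 0 i / x 0 i)%:C * Delta_pow mu x).
Proof.
move=> x0; have D0 : Delta x != 0 by apply/prodf_neq0.
set s := Num.sg (Delta x); set S := \sum_i _.
have sD0 : 0 < s * Delta x by rewrite -normrEsg normr_gt0.
pose th : R := if Delta x < 0 then pi else 0.
(* Delta keeps its sign near t = 0, so there the principal logarithm is a real logarithm plus the
   constant i [th], and the branch cut does not interfere. *)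
pose L (t : R) : C := - mu * ((ln (s * Delta (x + t *: v)))%:C + (0 +i* th)).
have LE y : 0 < s * Delta y -> LogR (Delta y) = (ln (s * Delta y))%:C + (0 +i* th).
  rewrite /s /th /LogR; case: (ltgtP (Delta x) 0) D0 => // [lt|gt] _.
    rewrite (ltr0_sg lt) mulN1r oppr_gt0 => Dy.
    by rewrite Dy ltr0_norm //; apply/eqP; rewrite eq_complex /= addr0 add0r !eqxx.
  rewrite (gtr0_sg gt) mul1r => Dy.
  by rewrite gtr0_norm // lt_gtF //; apply/eqP; rewrite eq_complex /= addr0 add0r !eqxx.
have dD : is_derive (0 : R) (1 : R) (fun t : R => Delta (x + t *: v)) (Delta x * S).
  have := is_derive_prod (fun i t => (x + t *: v) 0 i) (v 0) 0.
  rewrite scale0r addr0; apply => // i; exact: is_derive_line.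
have dl : is_derive (0 : R) (1 : R) (fun t : R => ln (s * Delta (x + t *: v))) S.
  have sD : is_derive (0 : R) (1 : R) (fun t : R => s * Delta (x + t *: v))
      (s * (Delta x * S)).
    have := is_deriveM (is_derive_cst s (0 : R) (1 : R)) dD; congr is_derive.
    by rewrite /GRing.scale /= mulr0 addr0.
  have := is_derive1_comp (is_derive1_ln _) sD; rewrite /= scale0r addr0 => /(_ sD0).
  by congr is_derive; rewrite (mulrA s) mulKf // gt_eqF.
have dL : is_cderive 0 L (- mu * S%:C).
  have := is_cderiveM _ _ _ _ _ (is_cderive_cst 0 (- mu))
    (is_cderiveD _ _ _ _ _ (is_cderive_real _ _ _ dl) (is_cderive_cst 0 (0 +i* th))).
  by congr is_cderive; rewrite mul0r add0r addr0.
have := is_cderive_cexp _ _ _ dL.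
have -> : cexp (L 0) = Delta_pow mu x by rewrite /L scale0r addr0 -LE.
apply: is_cderive_near; have := Delta_line_near x v x0.
by apply: filterS => t Dt; rewrite /Delta_pow LE.
Qed.

Definition inv_rep mu (p : {mpoly C[n]}) x : C :=
  meval (fun i => ((x 0 i)^-1)%:C) p * Delta_pow mu x.

(** [f] is prescribed only off the coordinate hyperplanes; this suffices because a short piece of
    the line through [x] stays there. *)
Lemma cderive_inv_rep mu p (f : vec -> C) x v : (forall i, x 0 i != 0) ->
  (forall y : vec, (forall i, y 0 i != 0) -> f y = inv_rep mu p y) ->
  cderive f x v =
  (meval_deriv (fun i => ((x 0 i)^-1)%:C)
      (fun i => - ((v 0 i)%:C * ((x 0 i)^-1)%:C ^+ 2)) p
   - mu * (\sum_i v 0 i / x 0 i)%:C * meval (fun i => ((x 0 i)^-1)%:C) p)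
  * Delta_pow mu x.
Proof.
move=> x0 fE; apply: cderive_line.
apply: (@is_cderive_near _ _ (fun t => inv_rep mu p (x + t *: v))).
  have := Delta_line_near x v x0; apply: filterS => t Dt; rewrite fE //.
  have : Delta (x + t *: v) != 0 by apply: contraTneq Dt => ->; rewrite mulr0 ltxx.
  by move/prodf_neq0 => H i; apply: H.
have dinv i : is_cderive 0 (fun t : R => (((x + t *: v) 0 i)^-1)%:C)
    (- ((v 0 i)%:C * ((x 0 i)^-1)%:C ^+ 2)).
  have xi : (x + (0 : R) *: v) 0 i != 0 by rewrite scale0r addr0.
  have := is_cderive_real _ _ _ (is_deriveV xi (is_derive_line x v i)).
  congr is_cderive; rewrite scale0r addr0 -rmorphXn -rmorphM -rmorphN.
  by congr _%:C; rewrite /GRing.scale /= exprVn mulNr mulrC.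
have := is_cderiveM _ _ _ _ _ (is_cderive_meval _ _ _ _ p dinv)
  (is_cderive_Delta_pow mu x v x0).
congr is_cderive; rewrite scale0r addr0; ring.
Qed.

End DeltaPower.

(** * Polynomials as functions on real vectors *)

Section PolynomialFunctions.
Import numFieldNormedType.Exports.
Context {R : realType} {n : nat}.
Local Notation C := R[i].
Local Notation vec := 'rV[R]_n.
Implicit Types (x v : vec) (p : {mpoly C[n]}).

Definition mfun p x : C := meval (fun i => (x 0 i)%:C) p.

Lemma cderive_mfun p x v :
  cderive (mfun p) x v = meval_deriv (fun i => (x 0 i)%:C) (fun i => (v 0 i)%:C) p.
Proof.
apply: cderive_line.
have := is_cderive_meval n 0 (fun i t => ((x + t *: v) 0 i)%:C) _ p
  (fun i => is_cderive_real _ _ _ (is_derive_line x v i)).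
by rewrite scale0r addr0.
Qed.

Lemma mfun_eq0 p : (forall x, mfun p x = 0) -> p = 0.
Proof.
move=> p0; apply/mpolyP => m; rewrite mcoeff0.
elim/mnm_ind: m p p0 => [|i m IH] p p0.
  have := p0 0; rewrite /mfun (_ : (fun i => _) = fun=> 0); last first.
    by apply/funext => i; rewrite mxE.
  move=> <-; elim/(@mpoly_indX C): p {p0} => [|c p q IHp IHq|l p IHp].
  - by rewrite mcoeff1 eqxx meval1.
  - by rewrite mcoeffD mcoeffZ mevalD mevalZ IHp IHq.
  by rewrite mevalM mevalXU mul0r (rmorphM (mcoeff 0%MM)) /= mcoeffX mnm1_eq0 mul0r.
(* The derivative vanishes at all real points too; its coefficient at [m] is a nonzero integer
   multiple of the one sought. *)
have : p^`M(i)@_m = 0.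
  apply: IH => x; have := cderive_mfun p x (ev R i).
  have -> : cderive (mfun p) x (ev R i) = 0.
    rewrite (_ : mfun p = fun=> 0); last exact/funext.
    by apply: cderive_line; apply: is_cderive_cst.
  rewrite /meval_deriv (bigD1 i) //= mxE !eqxx mul1r big1 ?addr0 // => j ji.
  by rewrite mxE (negPf ji) andbF mul0r.
rewrite mcoeff_mderiv addmC => /eqP; rewrite mulrn_eq0 => /orP[//|/eqP//].
Qed.

Lemma mfun_swap p i j x : mfun p (swap i j x) = mfun (msym (tperm i j) p) x.
Proof. by rewrite /mfun meval_msym; apply: meval_eq => l; rewrite mxE. Qed.

Lemma ddiff_mfun p i j x : i != j -> ddiff (mfun p) i j x = mfun (mddiff i j p) x.
Proof.
move=> ij; rewrite /ddiff; case: eqVneq => [xij|xij] /=.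
  rewrite cderive_mfun /mfun meval_mddiff_diag ?xij // /meval_deriv.
  rewrite (bigD1 i) // (bigD1 j) /=; last by rewrite eq_sym.
  rewrite !mxE !eqxx (negPf ij) [j == i]eq_sym (negPf ij) /= subr0 sub0r mul1r.
  rewrite rmorphN mulN1r big1 ?addr0 // => l /andP[li lj].
  by rewrite !mxE (negPf li) (negPf lj) subrr mul0r.
rewrite mfun_swap /mfun -mevalB -mddiffE mevalM mevalB !mevalXU -rmorphB.
by rewrite mulrAC divff ?mul1r // fmorph_eq0 subr_eq0.
Qed.

(** The weights xi_i - xi_j select the pairs containing [l]; antisymmetry of [c] merges those below
    and those above [l] into one sum. *)
Lemma dunkl_ddiff (k : R) (l : 'I_n) (f : vec -> C) x (c : 'I_n -> 'I_n -> C) :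
  (forall i j, i != j -> ddiff f i j x = c i j) ->
  (forall i j, c j i = - c i j) ->
  dunkl k (ev R l) f x = cderive f x (ev R l) + k%:C * \sum_(j | j != l) c l j.
Proof.
move=> fc cC; rewrite /dunkl; congr (_ + _ * _).
rewrite (eq_bigr (fun i : 'I_n => \sum_(j < n | (i < j)%N) (i == l)%:R * c i j
   - \sum_(j < n | (i < j)%N) (j == l)%:R * c i j)); last first.
  move=> i _; rewrite -sumrB; apply: eq_bigr => j ij.
  rewrite fc; last by apply: contraTneq ij => ->; rewrite ltnn.
  by rewrite !mxE eqxx /= rmorphB !rmorph_nat mulrBl.
have E1 : \sum_(i < n) \sum_(j < n | (i < j)%N) (i == l)%:R * c i j =
    \sum_(j < n | (l < j)%N) c l j.
  rewrite (bigD1 l) //= [X in _ + X]big1 => [|i /negPf il]; last first.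
    by apply: big1 => j _; rewrite il mul0r.
  by rewrite addr0; apply: eq_bigr => j _; rewrite eqxx mul1r.
have E2 : \sum_(i < n) \sum_(j < n | (i < j)%N) (j == l)%:R * c i j =
    - \sum_(i < n | (i < l)%N) c l i.
  rewrite (exchange_big_dep xpredT) //= (bigD1 l) //= [X in _ + X]big1; last first.
    by move=> j /negPf jl; apply: big1 => i _; rewrite jl mul0r.
  by rewrite addr0 -sumrN; apply: eq_bigr => i _; rewrite eqxx mul1r cC.
rewrite sumrB E1 E2 opprK.
rewrite [RHS](bigID (fun j : 'I_n => (l < j)%N)) /=.
by congr (_ + _); apply: eq_bigl => j; rewrite -(inj_eq val_inj) /=; case: ltngtP.
Qed.

Lemma dunkl_mfun (k : R) l p x :
  dunkl k (ev R l) (mfun p) x = mfun (mdunkl k%:C l p) x.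
Proof.
rewrite (dunkl_ddiff _ _ _ _ (fun i j => mfun (mddiff i j p) x)); last 2 first.
- by move=> i j; exact: ddiff_mfun.
- by move=> i j; rewrite mddiffC /mfun mevalN.
rewrite cderive_mfun /mfun mdunkl.unlock mevalD mevalZ.
congr (_ + _ * _); last by rewrite (raddf_sum (meval _)).
rewrite /meval_deriv (bigD1 l) //= mxE !eqxx mul1r big1 ?addr0 // => j jl.
by rewrite mxE (negPf jl) andbF mul0r.
Qed.

Lemma cherD_mfun (k : R) l p x :
  cherD k l (mfun p) x = mfun (mcherednik k%:C l p) x.
Proof.
rewrite /cherD dunkl_mfun mcherednik.unlock /mfun !mevalD mevalM !mevalZ mevalXU.
rewrite rmorphM rmorphB rmorph1 rmorph_nat.
congr (_ + _ * _); rewrite (raddf_sum (meval _)); apply: eq_bigr => i _.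
by rewrite -/(mfun p _) mfun_swap tpermC.
Qed.

End PolynomialFunctions.

(** * Dunkl operators on p(1/x) Delta^-mu *)

Section DunklDeltaPower.
Context {R : realType} {n : nat} (k : R) (mu : R[i]).
Local Notation C := R[i].
Local Notation vec := 'rV[R]_n.
Implicit Types (x v : vec) (p : {mpoly C[n]}).

Lemma Delta_pow_swap i j x : Delta_pow mu (swap i j x) = Delta_pow mu x.
Proof.
rewrite /Delta_pow; suff -> : Delta (swap i j x) = Delta x by [].
rewrite /Delta [RHS](reindex_inj (@perm_inj _ (tperm i j))) /=.
by apply: eq_bigr => l _; rewrite mxE.
Qed.

Lemma inv_rep_swap i j p x :
  inv_rep mu p (swap i j x) = inv_rep mu (msym (tperm i j) p) x.
Proof.
rewrite /inv_rep Delta_pow_swap meval_msym.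
suff /meval_eq -> : (fun l => ((swap i j x 0 l)^-1)%:C) =1
  (fun l => ((x 0 (tperm i j l))^-1)%:C) by [].
by move=> l; rewrite mxE.
Qed.

Lemma cderive_inv_repE p (f : vec -> C) x v (y := fun i => ((x 0 i)^-1)%:C) :
  (forall i, x 0 i != 0) ->
  (forall y : vec, (forall i, y 0 i != 0) -> f y = inv_rep mu p y) ->
  cderive f x v = - (\sum_i (v 0 i)%:C *
    (y i * (y i * meval y p^`M(i) + mu * meval y p))) * Delta_pow mu x.
Proof.
move=> x0 fE; rewrite (cderive_inv_rep _ _ _ _ _ x0 fE) /meval_deriv -/y.
pose Q i := meval y p^`M(i); rewrite -[RHS]/(- (\sum_i (v 0 i)%:C *
    (y i * (y i * Q i + mu * meval y p))) * Delta_pow mu x).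
rewrite (eq_bigr (fun i => - ((v 0 i)%:C * y i ^+ 2) * Q i)) //.
move: (meval y p) Q (Delta_pow mu x) => P Q D.
rewrite (rmorph_sum (real_complex R)) mulr_sumr mulr_suml -sumrB -sumrN; congr (_ * _).
by apply: eq_bigr => i _; rewrite rmorphM -/(y i) /=; ring.
Qed.

(** Delta^-mu is symmetric and factors out. Off the diagonal, 1/(x_i - x_j) = - y_i y_j / (y_i -
    y_j); on it, the derivatives in y_i and y_j carry the same factor - y_i^2 and the mu terms
    cancel. *)
Lemma ddiff_inv_rep p (f : vec -> C) x i j (y := fun i => ((x 0 i)^-1)%:C) :
  i != j -> (forall l, x 0 l != 0) ->
  (forall y : vec, (forall l, y 0 l != 0) -> f y = inv_rep mu p y) ->
  ddiff f i j x = - (y i * y j * meval y (mddiff i j p)) * Delta_pow mu x.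
Proof.
move=> ij x0 fE; rewrite /ddiff; case: eqVneq => [xij|xij] /=.
  have yij : y i = y j by rewrite /y xij.
  rewrite (cderive_inv_repE _ _ _ _ x0 fE) -/y (meval_mddiff_diag _ _ _ _ ij yij).
  move: (meval y p) (Delta_pow mu x) => P D.
  rewrite (bigD1 i) // (bigD1 j) /=; last by rewrite eq_sym.
  rewrite !mxE !eqxx (negPf ij) [j == i]eq_sym (negPf ij) /= subr0 sub0r mul1r.
  rewrite rmorphN mulN1r big1 ?addr0 => [|l /andP[li lj]]; last first.
    by rewrite !mxE (negPf li) (negPf lj) subrr mul0r.
  move: (meval y p^`M(i)) (meval y p^`M(j)) => Q Q'.
  by rewrite /y xij; ring.
rewrite !fE // => [|l]; last by rewrite mxE.
rewrite inv_rep_swap /inv_rep -mulrBl mevalB_msym -/y.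
move: (meval y _) (Delta_pow mu x) => P D.
have xC l : (x 0 l)%:C != 0 :> C by rewrite fmorph_eq0.
have xijC : (x 0 i)%:C - (x 0 j)%:C != 0 :> C by rewrite -rmorphB fmorph_eq0 subr_eq0.
by rewrite rmorphB /y !fmorphV; field; rewrite !xC xijC.
Qed.

Lemma dunkl_inv_rep p (f : vec -> C) l x : (forall i, x 0 i != 0) ->
  (forall y : vec, (forall i, y 0 i != 0) -> f y = inv_rep mu p y) ->
  dunkl k (ev R l) f x = inv_rep mu (idunkl k%:C mu l p) x.
Proof.
move=> x0 fE; pose y i := ((x 0 i)^-1)%:C.
pose c i j := - (y i * y j * meval y (mddiff i j p)) * Delta_pow mu x.
rewrite (dunkl_ddiff _ _ _ _ c); last 2 first.
- by move=> i j ij; apply: ddiff_inv_rep.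
- by move=> i j; rewrite /c mddiffC mevalN; ring.
rewrite (cderive_inv_repE _ _ _ _ x0 fE) -/y (bigD1 l) //= mxE !eqxx mul1r.
rewrite big1 ?addr0 => [|j jl]; last by rewrite mxE (negPf jl) andbF mul0r.
by rewrite /c -mulr_suml mulrA -mulrDl /inv_rep meval_idunkl.
Qed.

Lemma inv_rep1 x : inv_rep mu 1 x = Delta_pow mu x.
Proof. by rewrite /inv_rep meval1 mul1r. Qed.

Lemma dunkl_mono_inv_rep m x : (forall i, x 0 i != 0) ->
  dunkl_mono k m (Delta_pow mu) x = inv_rep mu (idunkl_mono k%:C mu m) x.
Proof.
rewrite /dunkl_mono /idunkl_mono; elim: (enum _) x => [|j r IH] x x0 /=.
  by rewrite inv_rep1.
by elim: (m j) x x0 => [|d IHd] x x0 /=; [exact: IH | exact: dunkl_inv_rep].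
Qed.

Lemma dunkl_poly_inv_rep (E : {mpoly R[n]}) x : (forall i, x 0 i != 0) ->
  dunkl_poly k E (Delta_pow mu) x =
  inv_rep mu (idunkl_poly k%:C mu (map_mpoly (real_complex R) E)) x.
Proof.
move=> x0; rewrite /dunkl_poly /idunkl_poly.
rewrite (perm_big _ (msupp_map_mpoly E (fmorph_inj (real_complex R)))) /=.
rewrite /inv_rep (raddf_sum (meval _)) mulr_suml; apply: eq_bigr => m _.
by rewrite /= mcoeff_map_mpoly dunkl_mono_inv_rep // mevalZ -mulrA.
Qed.

End DunklDeltaPower.

(** * Jack polynomials and their eigenvalues *)

Section NonsymmetricJack.
Context {R : realType} {n : nat} (k : R) (k_ge0 : 0 <= k).
Local Notation C := R[i].

Lemma meval_map_complex (v : 'I_n -> R) (p : {mpoly R[n]}) :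
  (meval v p)%:C = meval (fun i => (v i)%:C) (map_mpoly (real_complex R) p).
Proof. exact/esym/meval_map_mpoly. Qed.

Lemma nth_mseq (m : 'X_{1..n}) (j : 'I_n) : nth 0%N (mseq m) j = m j.
Proof. by rewrite [RHS](mnm_nth 0%N). Qed.

(** The two index sets counted in [ebar] are disjoint, and together they are the positions preceding
    [j]. *)
Lemma ebar_meig (m : 'X_{1..n}) j : (ebar k (mseq m) j)%:C = meig k%:C m j.
Proof.
rewrite /ebar /meig nth_mseq -addrA -opprD -mulrDr -natrD -cardsUI.
rewrite (_ : _ :&: _ = finset.set0); last first.
  by apply/setP => i; rewrite !inE; lia.
rewrite cards0 addn0 (_ : _ :|: _ = [set i | mprec m i j]); last first.
  apply/setP => i; rewrite !inE /mprec !nth_mseq.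
  have [->|] := eqVneq i j; first by lia.
  by rewrite -(inj_eq val_inj) /=; lia.
by rewrite rmorphB rmorphM !rmorph_nat.
Qed.

(** The Cherednik equations are given pointwise on real vectors; [mfun_eq0] lifts them to
    polynomials. *)
Lemma jack_mcherednik (m : 'X_{1..n}) (E : {mpoly R[n]}) j : is_Ejack k m E ->
  mcherednik k%:C j (map_mpoly (real_complex R) E) =
  meig k%:C m j *: map_mpoly (real_complex R) E.
Proof.
case=> _ _ DE; apply/eqP; rewrite -subr_eq0; apply/eqP/mfun_eq0 => x.
rewrite /mfun mevalB mevalZ -!/(mfun _ _) -cherD_mfun.
have fE : pfun E = mfun (map_mpoly (real_complex R) E).
  by apply/funext => y; rewrite /pfun meval_map_complex.
by rewrite -fE DE ebar_meig subrr.
Qed.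

(** Listing the exponents by rank gives a decreasing permutation of [mseq m], and such a list is
    unique. *)
Lemma nth_sortd (m : 'X_{1..n}) j : nth 0%N (sortd (mseq m)) (mrank m j) = m j.
Proof.
pose r (i : 'I_n) := Ordinal (mrank_lt m i).
have r_inj : injective r by move=> a b /(congr1 val) /mrank_inj.
pose s := perm r_inj; pose t := [seq m ((s^-1)%g i) | i <- enum 'I_n].
suff -> : sortd (mseq m) = t.
  rewrite (nth_map j) ?size_enum_ord ?mrank_lt //.
  rewrite -[mrank m j]/(val (r j)) nth_ord_enum.
  by rewrite -[r j](permE r_inj) permK.
apply: (@sorted_eq _ geq).
- by move=> a b c; rewrite /geq /=; lia.
- by move=> a b; rewrite /geq /=; lia.
- by apply: sort_sorted => a b; rewrite /geq /=; lia.
- apply/(sortedP 0%N) => i; rewrite size_map size_enum_ord => i1n.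
  have i_n : (i < n)%N by exact: ltnW.
  pose a := Ordinal i_n; pose b := Ordinal i1n.
  have E c : nth 0%N t (val c) = m ((s^-1)%g c).
    by rewrite (nth_map j) ?size_enum_ord ?ltn_ord // nth_ord_enum.
  rewrite (E a) (E b) /geq /= leqNgt; apply/negP => lt_ab.
  have /ltn_mrank : mprec m ((s^-1)%g b) ((s^-1)%g a) by rewrite /mprec lt_ab.
  have rs c : mrank m ((s^-1)%g c) = c.
    by rewrite -[mrank _ _]/(val (r _)) -(permE r_inj) permKV.
  by rewrite !rs /= ltnNge leqnSn.
have sz : size (mseq m) = n by exact: size_tuple.
rewrite perm_sort /t; have -> : mseq m = [seq m i | i <- enum 'I_n].
  apply: (@eq_from_nth _ 0%N) => [|i].
    by rewrite sz size_map size_enum_ord.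
  rewrite sz => i_n.
  by rewrite (nth_map j) ?size_enum_ord // (nth_ord_enum j (Ordinal i_n)) -nth_mseq.
rewrite (map_comp m (s^-1)%g) perm_sym; apply/perm_map/uniq_perm.
- by rewrite map_inj_uniq ?enum_uniq //; exact: perm_inj.
- exact: enum_uniq.
by move=> c; rewrite mem_enum -{1}[c](permK s) map_f ?mem_enum.
Qed.

(** The rank is a bijection of the indices, so the product over places can be reindexed by it. *)
Lemma mpoch_gen_poch (mu : C) (m : 'X_{1..n}) :
  mpoch k%:C mu m = (-1) ^+ mdeg m * gen_poch n k mu (sortd (mseq m)).
Proof.
rewrite /mpoch big_split /= mdegE prodrXr; congr (_ * _).
rewrite /gen_poch; pose r (i : 'I_n) := Ordinal (mrank_lt m i).
have r_inj : injective r by move=> a b /(congr1 val) /mrank_inj.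
rewrite [RHS](reindex_inj r_inj); apply: eq_bigr => j _ /=.
rewrite nth_sortd /poch; apply: eq_bigr => l _.
by rewrite rmorphM !rmorph_nat.
Qed.

Lemma jack_inv_rep (mu : C) (m : 'X_{1..n}) (E : {mpoly R[n]}) : is_Ejack k m E ->
  idunkl_poly k%:C mu (map_mpoly (real_complex R) E) =
  ((-1) ^+ mdeg m * gen_poch n k mu (sortd (mseq m))) *: map_mpoly (real_complex R) E.
Proof.
move=> JE; rewrite -mpoch_gen_poch; apply: idunkl_poly_eigen.
  by rewrite ler0c.
by move=> j; apply: jack_mcherednik.
Qed.

Lemma dunkl_poly_eigen (mu : C) a (E : {mpoly R[n]}) :
  idunkl_poly k%:C mu (map_mpoly (real_complex R) E) =
    a *: map_mpoly (real_complex R) E ->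
  forall x : 'rV[R]_n, (forall i, x 0 i != 0) ->
  dunkl_poly k E (Delta_pow mu) x =
  a * (meval (fun i => (x 0 i)^-1) E)%:C * Delta_pow mu x.
Proof.
move=> AE x x0; rewrite dunkl_poly_inv_rep // AE /inv_rep mevalZ.
by rewrite meval_map_complex.
Qed.

End NonsymmetricJack.

Theorem theorem3p3 (R : realType) (n : nat) (k : R) (hk : 0 <= k) :
  (forall (eta : mpoly.multinom n) (E : mpoly.mpoly n R), is_Ejack k eta E ->
     forall (mu : R[i]) (x : 'rV[R]_n), (forall i : 'I_n, x 0 i != 0) ->
       dunkl_poly k E (Delta_pow mu) x =
         (-1) ^+ mpoly.mdeg eta * gen_poch n k mu (sortd (mseq eta))
         * (mpoly.meval (fun i => (x 0 i)^-1) E)%:C * Delta_pow mu x)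
  /\
  (forall (lam : mpoly.multinom n) (P : mpoly.mpoly n R),
     sorted geq (mseq lam) -> is_Pjack k lam P ->
     forall (mu : R[i]) (x : 'rV[R]_n), (forall i : 'I_n, x 0 i != 0) ->
       dunkl_poly k P (Delta_pow mu) x =
         (-1) ^+ mpoly.mdeg lam * gen_poch n k mu (mseq lam)
         * (mpoly.meval (fun i => (x 0 i)^-1) P)%:C * Delta_pow mu x).
Proof.
split=> [eta E JE mu x x0 | lam P srt [E [JE [c [PE _]]]] mu x x0].
  exact: (dunkl_poly_eigen _ _ _ _ (jack_inv_rep _ hk mu _ _ JE)).
have -> : mseq lam = sortd (mseq lam).
  by rewrite /sortd (@sorted_sort _ geq) // => a b d; rewrite /geq /=; lia.
(* The eigenvalue passes to the symmetrization because [idunkl_poly] is linear and commutes with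
   permutations. *)
apply: dunkl_poly_eigen => //; rewrite PE map_mpoly_sum_msym.
by apply: idunkl_poly_sum_msym; apply: jack_inv_rep.
Qed.
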